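(* Let $\mu$ be doubling and let $X$ be a quasi-Banach function lattice over $(\mathcal P,\mu)$. Suppose that $\mathcal P$ supports a $p$-Poincaré inequality and let $s$ be such that the dimension condition holds with exponent $s$. Suppose that one of the following sets of assumptions is satisfied: (a) $p>s$ and $X\hookrightarrow L^p_{\mathrm{loc}}$; (b) $1=p=s$ and $X\hookrightarrow L^s(\log L)^\alpha_{\mathrm{loc}}$ for some $\alpha\ge1$; (c) $1<p=s$ and $X\hookrightarrow L^s(\log L)^\alpha_{\mathrm{loc}}$ for some $\alpha>1$; (d) $1\le p<s$ and $X\hookrightarrow L^{s,1}_{\mathrm{loc}}$. Then, for every function $u\in N^1X$, there is $v\in N^1X\cap C(\mathcal P)$ such that $u=v$ $C_X$-quasi-everywhere. Moreover, $v$ is locally $(1-s/p)$-Hölder continuous in the case (a).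
   Context: Setting. $\mathcal P=(\mathcal P,\mathrm d,\mu)$ is a metric space with a $\sigma$-finite Borel regular measure $\mu$ (all Borel sets are $\mu$-measurable, and every $\mu$-measurable set $A$ is contained in a Borel set $D$ with $\mu(D)=\mu(A)$) such that every ball has finite positive measure. A ball $B=B(x,r)$ is open and comes with its center and radius; $\lambda B=B(x,\lambda r)$. $u_B=\mu(B)^{-1}\int_Bu\,d\mu$. $\mathcal M(\mathcal P,\mu)$ is the set of all extended real-valued $\mu$-measurable functions on $\mathcal P$ (defined everywhere). $C(\mathcal P)$ denotes the (real-valued) continuous functions. Quasi-Banach function lattice: a linear space $X=\{u\in\mathcal M(\mathcal P,\mu):\|u\|_X<\infty\}$ given by a functional $\|\cdot\|_X:\mathcal M(\mathcal P,\mu)\to[0,\infty]$ such that: $\|u\|_X=0$ iff $u=0$ a.e.; $\|au\|_X=|a|\,\|u\|_X$ for $a\in\mathbb R$; there is a constant $c_\triangle\ge1$ with $\|u+v\|_X\le c_\triangle(\|u\|_X+\|v\|_X)$; if $|u|\le|v|$ a.e. then $\|u\|_X\le\|v\|_X$; and (Riesz--Fischer) if $u_n\ge0$ a.e. for all $n$ then $\|\sum_{n=1}^\infty u_n\|_X\le\sum_{n=1}^\infty c_\triangle^n\|u_n\|_X$. The quasi-norm is also assumed continuous: $\|u_n-u\|_X\to0$ implies $\|u_n\|_X\to\|u\|_X$. Newtonian space. A curve is a non-constant continuous map $\gamma$ from a compact interval into $\mathcal P$ of finite length, parametrized by arc length $ds$ on $[0,l_\gamma]$. A Borel function $g:\mathcal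 P\to[0,\infty]$ is an upper gradient of $u:\mathcal P\to[-\infty,\infty]$ if $|u(\gamma(0))-u(\gamma(l_\gamma))|\le\int_\gamma g\,ds$ for every curve $\gamma$, with the convention $|(\pm\infty)-(\pm\infty)|=\infty$. Set $\|u\|_{N^1X}=\|u\|_X+\inf_g\|g\|_X$, infimum over all upper gradients $g$ of $u$, and $N^1X=\{u\in\mathcal M(\mathcal P,\mu):\|u\|_{N^1X}<\infty\}$. Capacity. $C_X(E)=\inf\{\|u\|_{N^1X}:u\ge1\text{ on }E\}$; a property holds $C_X$-quasi-everywhere if the exceptional set has $C_X$-capacity zero. Doubling: there is $c_{\mathrm{dbl}}\ge1$ with $\mu(2B)\le c_{\mathrm{dbl}}\mu(B)$ for every ball $B$. Dimension condition with exponent $s>0$: there is $c_s>0$ with $\mu(B(y,r))/\mu(B(x,R))\ge c_s(r/R)^s$ whenever $0<r\le R$, $x\in\mathcal P$, $y\in B(x,R)$. $p$-Poincaré inequality ($p\in[1,\infty)$): there are $c_{\mathrm{PI}}>0$ and $\lambda\ge1$ such that $\frac1{\mu(B)}\int_B|u-u_B|\,d\mu\le c_{\mathrm{PI}}\,\mathrm{diam}(B)\bigl(\frac1{\mu(\lambda B)}\int_{\lambda B}g^p\,d\mu\bigr)^{1/p}$ for all balls $B$, all $u\in L^1_{\mathrm{loc}}(\mathcal P)$ and all upper gradients $g$ of $u$. Function spaces. The decreasing rearrangement is $f^*(t)=\inf\{\tau\ge0:\mu(\{|f|>\tau\})\le t\}$. Zygmund: for $p\ge1$, $\alpha\ge0$,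 $\mu(E)<\infty$, $\|u\|_{L^p(\log L)^\alpha(E)}^p=\int_0^{\mu(E)}\bigl(u^*(t)(1+\log\frac{\mu(E)}t)^\alpha\bigr)^p\,dt$. Lorentz: $\|u\|_{L^{p,1}}=\frac1p\int_0^\infty u^*(t)t^{1/p-1}\,dt$ for $1\le p<\infty$. $X\hookrightarrow Y_{\mathrm{loc}}$ means: for every ball $B$ there is $c_{\mathrm{emb}}(B)>0$ with $\|u\chi_B\|_{Y}\le c_{\mathrm{emb}}(B)\|u\chi_B\|_X$ for all $u\in\mathcal M(\mathcal P,\mu)$ (where the norm of $u\chi_B$ is taken in $Y(B)$ for $Y=L^s(\log L)^\alpha$). *)

(* Defs.v *)
From HB Require Import structures.
From mathcomp Require Import all_boot all_order all_algebra.
From mathcomp Require Import all_classical all_reals all_analysis.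
From mathcomp Require Import measurable_realfun.

Set Implicit Arguments.
Unset Strict Implicit.
Unset Printing Implicit Defensive.

Import Order.TTheory GRing.Theory Num.Theory.
Import numFieldNormedType.Exports.

Local Open Scope classical_set_scope.
Local Open Scope ring_scope.

(* The sigma-algebra and the metric are a priori unrelated: [borel_regular]
   below ties them together. *)
#[short(type="metricMeasurableType")]
HB.structure Definition MetricMeasurable (d : measure_display) (R : realType) :=
  {T of Metric R T & Measurable d T}.

Section metric_measure.
Local Open Scope ereal_scope.
Context {R : realType} {d : measure_display} {T : metricMeasurableType d R}.
Implicit Types (mu : {measure set T -> \bar R}) (u v g : T -> \bar R).
Implicit Types (x y : T) (r l a b t p s : R) (A B D E : set T).

Definition borel : set (set T) := <<s @open T >>.

Definition borel_regular mu :=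
  (forall A, borel A -> measurable A) /\
  (forall A, measurable A -> exists D, [/\ borel D, A `<=` D & mu D = mu A]).

Definition finite_positive_balls mu :=
  forall x r, (0 < r)%R -> 0 < mu (ball x r) < +oo.

Definition doubling mu :=
  exists2 c : R, (1 <= c)%R &
    forall x r, (0 < r)%R -> mu (ball x (2 * r)) <= c%:E * mu (ball x r).

Definition dimension_condition mu s :=
  exists2 c : R, (0 < c)%R &
    forall x y r (r' : R), (0 < r <= r')%R -> ball x r' y ->
      (c * (r / r') `^ s <= fine (mu (ball y r)) / fine (mu (ball x r')))%R.

Definition average mu B u : \bar R :=
  ((fine (mu B))^-1)%:E * \int[mu]_(x in B) u x.

Definition diameter B : \bar R :=
  ereal_sup [set (mdist x y)%:E | x in B & y in B].

(* As for embeddings, "loc" means on every ball, so that [u_B] makes sense. *)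
Definition locally_integrable1 mu u :=
  forall x r, (0 < r)%R -> mu.-integrable (ball x r) u.

(* Length of the restriction of [gamma] to [[a, b]]. *)
Definition curve_length a b (gamma : R -> T) : \bar R :=
  ereal_sup [set (\sum_(0 <= i < size q)
      mdist (gamma (nth b (a :: q) i)) (gamma (nth b (a :: q) i.+1)))%R%:E
    | q in itv_partition a b].

(* Only the values of [gamma] on [[0, l]] matter; the last clause says that
   [gamma] has length [l] and is parametrized by arc length. *)
Definition arclength_curve l (gamma : R -> T) :=
  [/\ {within `[0%R, l], continuous gamma},
      exists a b, [/\ a \in `[0%R, l], b \in `[0%R, l] & gamma a <> gamma b]
    & forall t, t \in `[0%R, l] -> curve_length 0 t gamma = t%:E].

(* Since [+oo - +oo] and [-oo - -oo] are both [-oo] in [\bar R], the left-hand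
   side of the inequality is [+oo] as soon as one of the two values is
   infinite. *)
Definition upper_gradient u g :=
  [/\ measurable_fun [set: g_sigma_algebraType (@open T)] g,
      forall x, 0 <= g x
    & forall l gamma, arclength_curve l gamma ->
      `|u (gamma 0%R) - u (gamma l)|
        <= \int[lebesgue_measure]_(t in `[0%R, l]) g (gamma t)].

Definition poincare mu p :=
  exists c lambda : R, [/\ (0 < c)%R, (1 <= lambda)%R &
    forall x r u g, (0 < r)%R -> locally_integrable1 mu u ->
      upper_gradient u g ->
      average mu (ball x r) (fun y => `|u y - average mu (ball x r) u|)
        <= c%:E * diameter (ball x r) *
           average mu (ball x (lambda * r)) (fun y => g y `^ p) `^ p^-1].

(* Sums of extended real-valued functions use the convention
   [+oo + -oo = -oo]. It is harmless: by homogeneity and monotonicity a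
   function of finite quasi-norm is finite a.e., so an indeterminate sum on a
   set of positive measure only occurs when the right-hand side of [qb_triangle]
   is [+oo]. *)
Record quasi_banach_with mu (c : R) (N : (T -> \bar R) -> \bar R) : Prop := {
  qb_ge0 : forall u, measurable_fun setT u -> 0 <= N u ;
  qb_eq0 : forall u, measurable_fun setT u ->
    (N u = 0 <-> {ae mu, forall x, u x = 0}) ;
  qb_homogeneous : forall (k : R) u, measurable_fun setT u ->
    N (fun x => k%:E * u x) = `|k|%:E * N u ;
  qb_triangle : forall u v, measurable_fun setT u -> measurable_fun setT v ->
    N (fun x => u x + v x) <= c%:E * (N u + N v) ;
  qb_lattice : forall u v, measurable_fun setT u -> measurable_fun setT v ->
    {ae mu, forall x, `|u x| <= `|v x|} -> N u <= N v ;
  qb_riesz_fischer : forall u_ : (T -> \bar R)^nat,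
    (forall n, measurable_fun setT (u_ n)) ->
    (forall n, {ae mu, forall x, 0 <= u_ n x}) ->
    N (fun x => \sum_(1 <= n <oo) u_ n x)
      <= \sum_(1 <= n <oo) (c ^+ n)%:E * N (u_ n) ;
  qb_continuous : forall (u_ : (T -> \bar R)^nat) u,
    (forall n, measurable_fun setT (u_ n)) -> measurable_fun setT u ->
    (fun n => N (fun x => u_ n x - u x)) @ \oo --> 0 ->
    (fun n => N (u_ n)) @ \oo --> N u }.

Definition quasi_banach_function_lattice mu N :=
  exists2 c : R, (1 <= c)%R & quasi_banach_with mu c N.

Section newtonian.
Variable N : (T -> \bar R) -> \bar R.

Definition newton_norm u : \bar R :=
  N u + ereal_inf [set N g | g in upper_gradient u].

Definition newton_space : set (T -> \bar R) :=
  [set u | measurable_fun setT u /\ newton_norm u < +oo].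

Definition capacity E : \bar R :=
  ereal_inf [set newton_norm u | u in
    [set u | measurable_fun setT u /\ forall x, E x -> 1 <= u x]].

Definition quasi_everywhere (P : T -> Prop) := capacity [set x | ~ P x] = 0.

(* [nY B f] is the quasi-norm in [Y] of [f = u \chi_B]; the extra argument [B]
   is for spaces [Y] whose quasi-norm depends on the ball. *)
Definition embeds_loc (nY : set T -> (T -> \bar R) -> \bar R) :=
  forall x r, (0 < r)%R -> exists2 c : R, (0 < c)%R &
    forall u, measurable_fun setT u ->
      nY (ball x r) (u \_ (ball x r)) <= c%:E * N (u \_ (ball x r)).

End newtonian.

Definition rearrangement mu u t : \bar R :=
  ereal_inf [set tau%:E | tau in
    [set tau : R | (0 <= tau)%R /\ mu [set x | tau%:E < `|u x|] <= t%:E]].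

Definition zygmund_norm mu p (alpha : R) E u : \bar R :=
  (\int[lebesgue_measure]_(t in `]0%R, fine (mu E)[)
     (rearrangement mu (u \_ E) t *
        ((1 + ln (fine (mu E) / t)) `^ alpha)%:E) `^ p) `^ p^-1.

Definition lorentz1_norm mu p u : \bar R :=
  (p^-1)%:E * \int[lebesgue_measure]_(t in `]0%R, +oo[)
     (rearrangement mu u t * (t `^ (p^-1 - 1))%:E).

(* "Locally" again means on every ball. *)
Definition locally_holder (beta : R) (v : T -> R) :=
  forall x r, (0 < r)%R -> exists2 c : R, (0 < c)%R &
    forall y z, ball x r y -> ball x r z ->
      (`|v y - v z| <= c * mdist y z `^ beta)%R.

End metric_measure.

(* Main.v *)
(* On a ball B, dyadic chaining in the Poincare inequality bounds the variation
   of the averages of u by the sums of r_k * (avg_{lambda B_k} g^p)^(1/p), with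
   r_k = 2^-k r.  The dimension condition gives mu(lambda B_k) >= t_k with t_k
   proportional to r_k^s, so splitting g along its rearrangement b_j = g^*(t_j)
   bounds the k-th mean by sum_j 2^(-s j) b_(k+j)^p, uniformly in the center.
   In each case the embedding makes b small enough for these terms to be
   summable (geometric in case (a)).  Hence the averages of u converge uniformly
   on balls to a continuous function v, Hoelder in case (a), and a covering by
   small balls gives u = v a.e.  Finally, on almost every curve, u and v are
   continuous and agree at almost all times, so that v has essentially the same
   upper gradients as u, and the indicator of {u <> v} has upper gradients of
   arbitrarily small norm. *)

Require Import Defs.
From HB Require Import structures.
From mathcomp Require Import all_boot all_order all_algebra.
From mathcomp Require Import all_classical all_reals all_analysis.
From mathcomp Require Import measurable_realfun.
From mathcomp Require Import zify ring lra.

Set Implicit Arguments.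
Unset Strict Implicit.
Unset Printing Implicit Defensive.

Import Order.TTheory GRing.Theory Num.Theory.
Import numFieldNormedType.Exports.

Local Open Scope classical_set_scope.
Local Open Scope ring_scope.

(** * Arc-length parametrized curves *)

Section curves.
Context {R : realType} {d : measure_display} {T : metricMeasurableType d R}.
Implicit Types (a b c l t : R) (gamma : R -> T) (q : seq R).

(** Exceptional families of curves never appear. Their role is played by a penalty equal to [+oo] on
    a Borel null set [D] containing the points where u and v differ, and to 0 elsewhere. Its
    quasi-norm is 0, so adding it to g is free. A curve along which the sum has infinite integral
    satisfies the upper gradient inequality trivially; any other curve meets [D] only at a null set
    of times, and then u = v at its two endpoints. Hence k g plus the penalty serves the indicator
    for every k > 0. The borderline exponents reflect how the p-th root meets the sum over j. For p
    < s the root moves inside, leaving a geometric factor. For p = s > 1 the logarithm leaves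
    k^(-alpha) after the root, summable for alpha > 1. For p = s = 1 there is no root: exchanging
    the sums counts the j-th term j + 1 times, which alpha = 1 already pays for. The function v must
    not depend on the ball in which it is studied: it is a limit along the radii 2^-k, and the
    working balls have radius 2^n, so that their dyadic scales are a shift of the same sequence. *)

Fixpoint polygon_length gamma a q : R :=
  if q is x :: q' then mdist (gamma a) (gamma x) + polygon_length gamma x q'
  else 0.

Lemma curve_lengthE a b gamma : curve_length a b gamma =
  ereal_sup [set (polygon_length gamma a q)%:E | q in itv_partition a b].
Proof.
rewrite /curve_length; congr (ereal_sup (image _ _)); apply/funext => q.
congr (_%:E); elim: q a => [|x q ih] a /=; first by rewrite big_geq.
by rewrite big_nat_recl//= ih.
Qed.

Lemma polygon_length_cat gamma a b q1 q2 : itv_partition a b q1 ->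
  polygon_length gamma a (q1 ++ q2) =
  polygon_length gamma a q1 + polygon_length gamma b q2.
Proof.
elim: q1 a => [|x q1 ih] a; first by move/itv_partition_nil => -> /=; rewrite add0r.
by move/itv_partition_cons => xb /=; rewrite (ih _ xb) addrA.
Qed.

(** The segment that crosses [c] is cut there, and the triangle inequality shows that the polygon
    does not get shorter. *)
Lemma polygon_length_split gamma a b c q : a <= c <= b ->
  itv_partition a b q -> exists q1 q2,
  [/\ itv_partition a c q1, itv_partition c b q2 &
   polygon_length gamma a q <=
   polygon_length gamma a q1 + polygon_length gamma c q2].
Proof.
elim: q a => [|x q ih] a /andP[ac cb] aq.
  have ab := itv_partition_nil aq.
  have -> : c = a by apply/eqP; rewrite eq_le ac ab cb.
  by exists [::], [::]; split; rewrite /itv_partition/= ?addr0// ab.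
have [/eqP ->|ca] := boolP (c == a).
  by exists [::], (x :: q); split => //=; rewrite add0r.
have {}ac : a < c by rewrite lt_neqAle eq_sym ca ac.
have [/andP[ax xq] /= lq] := aq.
have [cx|xc] := ltP c x.
  exists [:: c], (x :: q); split; rewrite /itv_partition /= ?ac ?cx//.
  by rewrite addr0 addrA lerD2r metric_triangle.
have [|q1 [q2 [xq1 cq2 le12]]] := ih x _ (itv_partition_cons aq).
  by rewrite xc.
exists (x :: q1), q2; split => //=.
  by case: xq1 => ? ?; split => //=; rewrite ax.
by rewrite -addrA lerD2l.
Qed.

Lemma polygon_length_le a b gamma q : itv_partition a b q ->
  ((polygon_length gamma a q)%:E <= curve_length a b gamma)%E.
Proof.
by move=> abq; rewrite curve_lengthE; apply: ereal_sup_ubound; exists q.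
Qed.

(** [arclength_curve] only records lengths measured from 0. Additivity of length gives the others:
    concatenating partitions yields one inequality, inserting [a] as a vertex the other. *)
Lemma curve_length_sub l gamma a b : arclength_curve l gamma ->
  0 <= a <= b -> b <= l -> curve_length a b gamma = (b - a)%:E.
Proof.
move=> [_ _ len] /andP[a0 ab] bl.
have La : curve_length 0 a gamma = a%:E.
  by apply: len; rewrite in_itv/= a0 (le_trans ab).
have Lb : curve_length 0 b gamma = b%:E.
  by apply: len; rewrite in_itv/= (le_trans a0).
apply/eqP; rewrite eq_le; apply/andP; split.
  rewrite curve_lengthE; apply: ge_ereal_sup => _ [q abq <-].
  rewrite lee_fin lerBrDr -lee_fin EFinD -leeBrDl// -[leLHS]La curve_lengthE.
  apply: ge_ereal_sup => _ [q' aq' <-].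
  rewrite -EFinB lee_fin lerBrDr -lee_fin -Lb.
  rewrite -(polygon_length_cat _ _ aq'); apply: polygon_length_le.
  exact: itv_partition_cat aq' abq.
rewrite EFinB leeBlDr// -[leLHS]Lb curve_lengthE.
apply: ge_ereal_sup => _ [q bq <-].
have [|q1 [q2 [aq1 bq2 le12]]] := polygon_length_split gamma (c := a) _ bq.
  by rewrite a0.
rewrite -La addeC.
have := leeD (polygon_length_le gamma aq1) (polygon_length_le gamma bq2).
by apply: le_trans; rewrite -EFinD lee_fin.
Qed.

Lemma arclength_lipschitz l gamma a b : arclength_curve l gamma ->
  0 <= a <= b -> b <= l -> mdist (gamma a) (gamma b) <= b - a.
Proof.
move=> lg ab bl; rewrite -lee_fin -(curve_length_sub lg ab bl).
have /andP[_] := ab; rewrite le_eqVlt => /predU1P[->|altb].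
  by rewrite mdistxx curve_lengthE; apply: ereal_sup_ubound; exists [::].
have := @polygon_length_le _ _ gamma _ (itv_partition1 altb).
by rewrite /= addr0.
Qed.

Lemma polygon_length_shift gamma a c q :
  polygon_length (fun t => gamma (c + t)) a q =
  polygon_length gamma (c + a) (map (+%R c) q).
Proof. by elim: q a => //= x q ih a; rewrite ih. Qed.

Lemma itv_partition_shift a b c q :
  itv_partition (c + a) (c + b) (map (+%R c) q) <-> itv_partition a b q.
Proof.
rewrite /itv_partition last_map (inj_eq (addrI c)).
suff -> : path <%R (c + a) (map (+%R c) q) = path <%R a q by [].
by elim: q a => //= x q ih a; rewrite ih ltrD2l.
Qed.

Lemma curve_length_shift gamma a b c :
  curve_length a b (fun t => gamma (c + t)) =
  curve_length (c + a) (c + b) gamma.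
Proof.
rewrite !curve_lengthE; congr ereal_sup; apply/seteqP; split => _ [q abq <-].
  exists (map (+%R c) q); first exact/itv_partition_shift.
  by rewrite polygon_length_shift.
exists (map (+%R (- c)) q); last first.
  rewrite polygon_length_shift -map_comp.
  congr ((polygon_length _ _ _)%:E); apply: map_id_in => x _ /=.
  by rewrite addrA subrr add0r.
apply/(itv_partition_shift _ _ c); rewrite -map_comp.
rewrite [X in itv_partition _ _ X](_ : _ = q)//.
by apply: map_id_in => x _ /=; rewrite addrA subrr add0r.
Qed.

Lemma polygon_length_const gamma a b q :
  (forall x, a <= x <= b -> gamma x = gamma a) ->
  itv_partition a b q -> polygon_length gamma a q = 0.
Proof.
elim: q a => //= x q ih a cst aq.
have xb := itv_partition_le (itv_partition_cons aq).
have [/andP[ax _] _] := aq.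
rewrite (cst x) ?(ltW ax)// mdistxx add0r ih//; last exact: itv_partition_cons aq.
by move=> y /andP[xy yb]; rewrite !cst ?(ltW ax)// ?yb ?(le_trans (ltW ax)).
Qed.

(* Projecting the parameter on [[0, l]] extends an arc-length parametrized
   curve to a 1-Lipschitz, hence continuous, map on the whole line. *)
Definition clamp l t : R := Num.min (Num.max 0 t) l.

Lemma clamp_id l t : t \in `[0, l] -> clamp l t = t.
Proof. by rewrite in_itv/= /clamp => /andP[t0 tl]; rewrite max_r// min_l. Qed.

Lemma clamp_in l t : 0 <= l -> 0 <= clamp l t <= l.
Proof. by move=> l0; rewrite /clamp ge_min lexx orbT andbT le_min l0 le_max lexx. Qed.

Lemma clamp_lipschitz l t t' : t <= t' ->
  clamp l t <= clamp l t' /\ clamp l t' - clamp l t <= t' - t.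
Proof.
move=> tt'; rewrite /clamp.
have [h1|h1] := leP 0 t; have [h2|h2] := leP 0 t'; split;
  do 2?case: (leP _ l) => ?; lra.
Qed.

Lemma lipschitz_clamp_continuous l gamma : 0 <= l ->
  (forall a b, 0 <= a <= b -> b <= l -> mdist (gamma a) (gamma b) <= b - a) ->
  continuous (gamma \o clamp l : R -> T).
Proof.
move=> l0 lip.
have lip' a b : a <= b ->
    mdist ((gamma \o clamp l) a) ((gamma \o clamp l) b) <= b - a.
  move=> ab; have [mo li] := clamp_lipschitz l ab; apply: le_trans li.
  have /andP[ca _] := clamp_in a l0; have /andP[_ cb] := clamp_in b l0.
  by apply: lip => //; rewrite ca.
move=> x; apply/metricType_numDomainType.cvgrPdist_lt => e e0.
near=> y.
have xy : `|x - y| < e.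
  by near: y; exact: cvgr_dist_lt.
have [xley|/ltW ylex] := leP x y.
  rewrite (le_lt_trans (lip' _ _ xley))//.
  by rewrite (le_lt_trans _ xy)// distrC ler_norm.
rewrite metric_sym (le_lt_trans (lip' _ _ ylex))//.
by rewrite (le_lt_trans _ xy)// ler_norm.
Unshelve. all: by end_near. Qed.

Lemma arclength_clamp_continuous l gamma : 0 <= l -> arclength_curve l gamma ->
  continuous (gamma \o clamp l : R -> T).
Proof.
move=> l0 lg; apply: lipschitz_clamp_continuous => // a b ab bl.
exact: arclength_lipschitz lg ab bl.
Qed.

(** Makes subcurves admissible in the definition of upper gradients. A constant subcurve would have
    length 0 instead of [b - a]. *)
Lemma arclength_sub l gamma a b : arclength_curve l gamma ->
  0 <= a < b -> b <= l -> arclength_curve (b - a) (fun t => gamma (a + t)).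
Proof.
move=> lg /andP[a0 ab] bl; split.
- have ba : 0 <= b - a by rewrite subr_ge0 ltW.
  have cg : continuous ((fun t => gamma (a + t)) \o clamp (b - a) : R -> T).
    apply: lipschitz_clamp_continuous => // x y /andP[x0 xy] yb.
    rewrite (le_trans (arclength_lipschitz lg _ _))//; lra.
  apply: (@subspace_eq_continuous _ _ _
    ((fun t => gamma (a + t)) \o clamp (b - a) : R -> T)).
    by move=> x; rewrite inE/= => xab; rewrite /from_subspace/= clamp_id.
  exact: continuous_subspaceT.
- apply: contrapT => /forallNP cst.
  suff : curve_length a b gamma = 0%:E.
    rewrite (curve_length_sub lg) ?a0 ?(ltW ab)// => -[] /eqP.
    by rewrite subr_eq0 gt_eqF.
  apply/eqP; rewrite eq_le; apply/andP; split; last first.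
    by rewrite (curve_length_sub lg) ?a0 ?(ltW ab)// lee_fin subr_ge0 ltW.
  rewrite curve_lengthE; apply: ge_ereal_sup => _ [q abq <-].
  rewrite (polygon_length_const _ abq)// => x /andP[ax xb].
  apply: contrapT => xa; apply: (cst (x - a)); exists 0; split.
  - by rewrite in_itv/= subr_ge0 ax lerD2r.
  - by rewrite in_itv/= lexx subr_ge0 ltW.
  - by rewrite addrC subrK addr0.
- move=> t; rewrite in_itv/= => /andP[t0 tb].
  rewrite curve_length_shift addr0 (curve_length_sub lg).
  + by congr EFin; rewrite addrAC subrr add0r.
  + by rewrite a0 lerDl.
  + by lra.
Qed.

End curves.

(** Absolute continuity of the integral. [F] may be infinite on a null set, so it is first replaced
    by the real-valued [f], which agrees a.e. with its restriction to [D]. *)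
Lemma small_integral d (T : measurableType d) (R : realType)
    (mu : {measure set T -> \bar R}) (D : set T) (F : T -> \bar R) (e : R) :
  measurable D -> measurable_fun D F -> (forall x, (0 <= F x)%E) ->
  (\int[mu]_(x in D) F x < +oo)%E -> 0 < e ->
  exists2 r : R, 0 < r & forall A, measurable A -> A `<=` D ->
    (mu A < r%:E)%E -> (\int[mu]_(x in A) F x < e%:E)%E.
Proof.
move=> mD mF F0 Foo e0.
have iF : mu.-integrable D F.
  by apply/integrableP; split => //; under eq_integral do rewrite gee0_abs//.
have iG : mu.-integrable setT (F \_ D) by rewrite -integrable_mkcond.
set G := F \_ D in iG.
have mG : measurable_fun setT G by case/integrableP: iG.
have G0 x : (0 <= G x)%E by exact: erestrict_ge0.
pose f := fine \o G.
have mf : measurable_fun setT f by apply: measurableT_comp.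
have if_ : mu.-integrable setT (EFin \o f).
  apply: le_integrable iG => //; first exact/measurable_EFinP.
  move=> x _ /=; rewrite /f /= ger0_norm ?fine_ge0//.
  by rewrite (gee0_abs (G0 x)); case: (G x) (G0 x) => //= *; rewrite leey.
have [r [r0 rP]] := integral_normr_continuous if_ e0.
exists r => // A mA AD Ar.
have -> : (\int[mu]_(x in A) F x = \int[mu]_(x in A) (`|f x|)%:E)%E.
  transitivity (\int[mu]_(x in A) G x)%E.
    by apply: eq_integral => x; rewrite inE => /AD Dx; rewrite /G patchT ?inE.
  apply: ge0_ae_eq_integral => //.
  - exact: measurable_funTS.
  - apply/measurable_EFinP; apply: measurable_funTS.
    exact: measurableT_comp.
  have := integrable_ae measurableT iG; apply: filterS => x /(_ I) fG _.
  by rewrite /f /= ger0_norm ?fine_ge0// fineK.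
have := rP A mA Ar; rewrite /Rintegral -lte_fin fineK//.
rewrite ge0_fin_numE; last by apply: integral_ge0 => x _; rewrite lee_fin.
case/integrableP: if_ => _; apply: le_lt_trans => /=.
apply: ge0_subset_integral => //.
by apply/measurable_EFinP; exact: measurableT_comp.
Qed.

Lemma abse_subC (R : realDomainType) (x y : \bar R) : (`|x - y| = `|y - x|)%E.
Proof. by case: x y => [x||] [y||] //=; rewrite distrC. Qed.

(** * Upper gradients and endpoint values along curves *)

Section curve_endpoints.
Context {R : realType} {d : measure_display} {T : metricMeasurableType d R}.
Local Notation borelT := (g_sigma_algebraType (@open T)).

Lemma arclength_gt0 l (gamma : R -> T) : arclength_curve l gamma -> 0 < l.
Proof.
move=> [_ [a [b [/[!in_itv]/= /andP[a0 al] /andP[b0 bl] gab]]] _].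
have l0 : 0 <= l by exact: le_trans a0 al.
rewrite lt_neqAle l0 andbT; apply/eqP => l0'; apply: gab.
by congr gamma; apply/eqP; rewrite eq_le; apply/andP; split; lra.
Qed.

(** Borel measurability of [g] is what composes with a continuous curve. The curve is continuous
    only within [[0, l]], hence the detour through [clamp]. *)
Lemma arclength_measurable_comp l (gamma : R -> T) (g : T -> \bar R) :
  arclength_curve l gamma -> measurable_fun [set: borelT] g ->
  measurable_fun `[0, l] (g \o gamma).
Proof.
move=> lg mg; have l0 := ltW (arclength_gt0 lg).
have mc : measurable_fun [set: R] (gamma \o clamp l : R -> borelT).
  apply: (@measurability _ _ _ borelT setT _ (@open T) erefl).
  move=> _ [A oA <-]; rewrite setTI; apply: open_measurable.
  by move: A oA; apply/continuousP; exact: arclength_clamp_continuous.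
have : measurable_fun `[0, l] (g \o (gamma \o clamp l : R -> borelT)).
  by apply: measurable_funTS; exact: (measurableT_comp mg mc).
by apply: eq_measurable_fun => x; rewrite inE/= => xl; rewrite clamp_id.
Qed.

(** Translation invariance, from the uniqueness of the measure that gives half-open intervals their
    length. *)
Lemma lebesgue_measure_shift (c : R) (A : set R) : measurable A ->
  pushforward lebesgue_measure (+%R c : _ -> measurableTypeR R) A =
  lebesgue_measure A.
Proof.
move=> mA.
have mc : measurable_fun setT (+%R c : measurableTypeR R -> measurableTypeR R).
  by apply: measurable_funD.
pose mix := isMeasurableFun.Build _ _ _ _ _ mc.
pose phi : {mfun measurableTypeR R >-> measurableTypeR R} :=
  HB.pack (+%R c : measurableTypeR R -> measurableTypeR R) mix.
apply/esym/(@lebesgue_measure_unique _ (pushforward lebesgue_measure phi)) => //=.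
move=> _ [[a b]] _ <-.
rewrite /pushforward [X in _ = lebesgue_measure X](_ : _ = `](a - c), (b - c)]%classic).
  rewrite !lebesgue_measure_itv/= !lte_fin ltrD2r -!EFinD.
  by case: ifP => // _; congr EFin; rewrite opprB addrA subrK.
by apply/seteqP; split => x /=; rewrite !in_itv/= ltrBlDl lerBrDl.
Qed.

Lemma ge0_integral_shift (c a b : R) (f : R -> \bar R) :
  measurable_fun `[c + a, c + b] f -> (forall x, 0 <= f x)%E ->
  (\int[lebesgue_measure]_(t in `[a, b]) f (c + t)%R =
   \int[lebesgue_measure]_(t in `[(c + a)%R, (c + b)%R]) f t)%E.
Proof.
move=> mf f0; rewrite (_ : `[a, b]%classic =
    (+%R c : _ -> measurableTypeR R) @^-1` `[c + a, c + b]); last first.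
  by apply/seteqP; split => x /=; rewrite !in_itv/= !lerD2l.
have mc : measurable_fun setT (+%R c : measurableTypeR R -> measurableTypeR R).
  by apply: measurable_funD.
rewrite -(@ge0_integral_pushforward _ _ _ _ _ _ mc)//=.
by apply: eq_measure_integral => //= A mA _; exact: lebesgue_measure_shift.
Qed.

Lemma upper_gradient_sub (u g : T -> \bar R) l (gamma : R -> T) a b :
  upper_gradient u g -> arclength_curve l gamma -> 0 <= a < b -> b <= l ->
  (`|u (gamma a) - u (gamma b)| <=
   \int[lebesgue_measure]_(t in `[a, b]) g (gamma t))%E.
Proof.
move=> [mg g0 ug] lg ab bl.
have := ug _ _ (arclength_sub lg ab bl).
rewrite /= addr0 subrKC (ge0_integral_shift (f := g \o gamma))//.
  by rewrite addr0 subrKC.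
- rewrite addr0 subrKC.
  have := arclength_measurable_comp lg mg; apply: measurable_funS => // x.
  by move: ab => /andP[a0 _] /=; rewrite !in_itv/= => /andP[ax xb]; lra.
- by move=> x /=; exact: g0.
Qed.

(* Along a curve on which [g] has finite integral and which spends no time in
   [D], both [u] (by the upper gradient inequality on short subcurves) and [v]
   are continuous at the endpoints, and they agree at almost all times. *)
Lemma upper_gradient_endpoints (u g : T -> \bar R) (v : T -> R) (D : set T)
    l (gamma : R -> T) :
  upper_gradient u g -> continuous v -> borel D ->
  (forall x, ~ D x -> u x = (v x)%:E) -> arclength_curve l gamma ->
  (\int[lebesgue_measure]_(t in `[0%R, l])
     (g (gamma t) + (\1_D (gamma t))%:E * +oo) < +oo)%E ->
  u (gamma 0) = (v (gamma 0))%:E /\ u (gamma l) = (v (gamma l))%:E.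
Proof.
move=> ug; have [mg g0 _] := ug; move=> cv bD uv lg ioo; have l0 := arclength_gt0 lg.
have mD1 : measurable_fun [set: borelT] (fun x => (\1_D x)%:E * +oo : \bar R)%E.
  apply: emeasurable_funM => //; apply/measurable_EFinP.
  exact: (@measurable_indic _ borelT).
have mh := arclength_measurable_comp lg (emeasurable_funD mg mD1).
have mgg := arclength_measurable_comp lg mg.
have h0 x : (0 <= (\1_D x)%:E * +oo :> \bar R)%E.
  by rewrite mule_ge0// lee_fin.
have igoo : (\int[lebesgue_measure]_(t in `[0%R, l]) g (gamma t) < +oo)%E.
  apply: le_lt_trans ioo; apply: ge0_le_integral => //.
  by move=> x _; rewrite leeDl.
(* The integrand is infinite whenever the curve is in [D], so a finite integral leaves only a null
   set of such times. *)
have aeD : {ae lebesgue_measure, forall t : R, t \in `[0, l] -> ~ D (gamma t)}.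
  have : lebesgue_measure.-integrable `[0, l]
      (fun t => g (gamma t) + (\1_D (gamma t))%:E * +oo)%E.
    apply/integrableP; split => //.
    by under eq_integral do rewrite gee0_abs ?adde_ge0//.
  move/integrable_ae => /(_ (measurable_itv _)); apply: filterS => t /[apply].
  move=> /[swap] Dt; rewrite indicE mem_set// mul1e addey//.
  by move: (g0 (gamma t)); case: (g (gamma t)).
(* Treats both endpoints at once: [c] is approached through one-sided intervals [A] of small
   positive length. *)
have key (c : R) : c \in `[0, l] ->
    (forall r : R, 0 < r -> exists A : set R, [/\ measurable A, A `<=` `[0, l],
      (0 < lebesgue_measure A < r%:E)%E &
      forall t, A t -> `|c - t| < r /\
        (`|u (gamma c) - u (gamma t)| <=
          \int[lebesgue_measure]_(t in A) g (gamma t))%E]) ->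
    u (gamma c) = (v (gamma c))%:E.
  move=> cl smallA.
  (* A set of times of positive measure contains some [t] with [gamma t] outside [D]. There [u]
     equals the finite [v], and the integral of [g] over the short set [A] bounds the jump from [c]
     to [t]. *)
  have close e : 0 < e -> exists2 y : R, (`|u (gamma c) - y%:E| <= e%:E)%E &
      `|v (gamma c) - y| < e.
    move=> e0.
    have [r r0 rP] := @small_integral _ _ _ lebesgue_measure _ _ e
      (measurable_itv _) mgg (fun t => g0 (gamma t)) igoo e0.
    have cvg : continuous (v \o (gamma \o clamp l) : R -> R).
      move=> x; apply: continuous_comp; last exact: cv.
      exact: (arclength_clamp_continuous (ltW l0) lg).
    have /cvgrPdist_lt/(_ _ e0)[r1 /= r10 r1P] := cvg c.
    have [|A [mA Al /andP[A0 Ar] AP]] := smallA (Num.min r r1).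
      by rewrite lt_min r0.
    have [t At Dt] : exists2 t, A t & ~ D (gamma t).
      apply: contrapT => noA; have [B [mB B0 BP]] := aeD.
      have AB : A `<=` B.
        move=> t At; apply: BP => /= /(_ (Al _ At)) Dt.
        by apply: noA; exists t.
      have : (lebesgue_measure A <= lebesgue_measure B)%E.
        by apply: le_measure; rewrite ?inE.
      by rewrite B0 leNgt A0.
    have [ct uct] := AP _ At.
    exists (v (gamma t)).
      rewrite (uv _ Dt) in uct; apply: (le_trans uct); apply/ltW/rP => //.
      by rewrite (lt_le_trans Ar)// lee_fin ge_min lexx.
    have := r1P t; rewrite /ball_ /= => /(_ (lt_le_trans ct _)).
    rewrite ge_min lexx orbT => /(_ isT).
    by rewrite !clamp_id//; exact: Al.
  (* An infinite value at [c] would be at infinite distance from every real [y]. *)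
  case: (u (gamma c)) close => [y||].
  - move=> close; congr EFin; apply/eqP; rewrite -subr_eq0 -normr_le0.
    apply/ler_addgt0Pr => e e0; rewrite add0r.
    have [|z] := close (e / 2); first by rewrite divr_gt0.
    rewrite -EFinB/= lee_fin => yz vz.
    rewrite (le_trans (ler_distD z _ _))// (splitr e) lerD//.
    by rewrite distrC ltW.
  - by move=> /(_ _ ltr01)[].
  - by move=> /(_ _ ltr01)[].
have mgab a b : 0 <= a -> b <= l -> measurable_fun `]a, b[ (g \o gamma).
  move=> a0 bl; apply: measurable_funS mgg => // x.
  by rewrite /= !in_itv/= => /andP[ax xb]; lra.
split; (apply: key => [|r r0]).
- by rewrite /= in_itv/= lexx ltW.
- pose t := Num.min (r / 2) l.
  have t0 : 0 < t by rewrite lt_min l0 divr_gt0.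
  have tl : t <= l by rewrite ge_min lexx orbT.
  have tr : t < r by rewrite gt_min ltr_pdivrMr// mulr_natr mulr2n ltrDl r0.
  exists `]0, t]%classic; split.
  + exact: measurable_itv.
  + by move=> x; rewrite /= !in_itv/= => /andP[x0 xt]; lra.
  + by rewrite lebesgue_measure_itv/= lte_fin t0 ?oppr0 ?oppe0 ?adde0 ?addr0 !lte_fin t0.
  + move=> x; rewrite /= in_itv/= => /andP[x0 xt]; split.
      by rewrite add0r normrN gtr0_norm// (le_lt_trans xt).
    apply: (le_trans (upper_gradient_sub (a := 0) (b := x) ug lg _ _)).
    - by rewrite lexx.
    - exact: le_trans xt tl.
    rewrite integral_itv_obnd_cbnd; last first.
      by apply: measurable_funS mgg => // y; rewrite /= !in_itv/=; lra.
    apply: ge0_subset_integral => //.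
    - by apply: measurable_funS mgg => // y; rewrite /= !in_itv/=; lra.
    - by move=> y; rewrite /= !in_itv/=; lra.
- by rewrite /= in_itv/= lexx ltW.
- pose t := Num.min (r / 2) l.
  have t0 : 0 < t by rewrite lt_min l0 divr_gt0.
  have tl : t <= l by rewrite ge_min lexx orbT.
  have tr : t < r by rewrite gt_min ltr_pdivrMr// mulr_natr mulr2n ltrDl r0.
  have ltl : l - t < l by rewrite ltrBlDr ltrDl.
  exists `[l - t, l[%classic; split.
  + exact: measurable_itv.
  + by move=> x; rewrite /= !in_itv/= => /andP[x0 xt]; lra.
  + rewrite lebesgue_measure_itv/= lte_fin ltl -EFinD opprB addrC subrK.
    by rewrite !lte_fin t0.
  + move=> x; rewrite /= in_itv/= => /andP[x0 xt]; split.
      by rewrite ger0_norm; lra.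
    rewrite abse_subC.
    apply: (le_trans (upper_gradient_sub (a := x) (b := l) ug lg _ _)) => //.
    - by rewrite xt; lra.
    rewrite integral_itv_bndo_bndc; last first.
      by apply: measurable_funS mgg => // y; rewrite /= !in_itv/=; lra.
    apply: ge0_subset_integral => //.
    - by apply: measurable_funS mgg => // y; rewrite /= !in_itv/=; lra.
    - by move=> y; rewrite /= !in_itv/=; lra.
Qed.
End curve_endpoints.

(** * Continuous representatives *)

Section newtonian_representatives.
Context {R : realType} {d : measure_display} {T : metricMeasurableType d R}.
Variable mu : {measure set T -> \bar R}.
Variable N : (T -> \bar R) -> \bar R.
Hypothesis mu_borel : borel_regular mu.
Hypothesis N_qb : quasi_banach_function_lattice mu N.
Local Notation borelT := (g_sigma_algebraType (@open T)).

Lemma open_measurableT (A : set T) : open A -> measurable A.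
Proof. by move=> oA; apply: mu_borel.1; exact: sub_gen_smallest. Qed.

Lemma borel_measurable_fun (g : T -> \bar R) :
  measurable_fun [set: borelT] g -> measurable_fun [set: T] g.
Proof.
move=> mg _ Y mY; rewrite setTI; apply: mu_borel.1.
by have := mg measurableT Y mY; rewrite setTI.
Qed.

Lemma continuous_measurable_funT (v : T -> R) :
  continuous v -> measurable_fun [set: T] v.
Proof.
move=> /continuousP cv; apply: (measurability _ (RGenOpens.measurableE R)).
move=> _ [_ [a [b ->] <-]]; rewrite setTI.
by apply: open_measurableT; apply: cv; exact: interval_open.
Qed.

Lemma upper_gradient_measurable (u g : T -> \bar R) :
  upper_gradient u g -> measurable_fun [set: T] g.
Proof. by case=> mg _ _; exact: borel_measurable_fun. Qed.

Lemma newton_spaceP (u : T -> \bar R) : newton_space N u <->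
  [/\ measurable_fun setT u, (N u < +oo)%E &
   exists2 g, upper_gradient u g & (N g < +oo)%E].
Proof.
have [c _ qb] := N_qb.
have inf0 : (0 <= ereal_inf [set N g | g in upper_gradient u])%E.
  apply: le_ereal_inf_tmp => _ [g ug <-].
  exact: (qb_ge0 qb (upper_gradient_measurable ug)).
split.
  move=> [mu_ nu]; have Nu0 := qb_ge0 qb mu_.
  have Nuoo : (N u < +oo)%E by apply: le_lt_trans nu; rewrite leeDl.
  split => //.
  have : (ereal_inf [set N g | g in upper_gradient u] < +oo)%E.
    by apply: le_lt_trans nu; rewrite leeDr.
  by move/ereal_inf_lt => [_ [g ug <-] goo]; exists g.
move=> [mu_ Nuoo [g ug goo]]; split=> //; rewrite /newton_norm lte_add_pinfty//.
by apply: le_lt_trans goo; apply: ereal_inf_lbound; exists g.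
Qed.

(** Since [0 * +oo = 0], the function vanishes off [D], hence a.e. *)
Lemma lattice_null (D : set T) : measurable D -> mu D = 0 ->
  N (fun x => (\1_D x)%:E * +oo)%E = 0.
Proof.
move=> mD D0; have [c _ qb] := N_qb; apply/(qb_eq0 qb).
  by apply: emeasurable_funM => //; apply/measurable_EFinP; exact: measurable_indic.
exists D; split => // x /= h; apply: contrapT => Dx; apply: h.
by rewrite indicE memNset// mul0e.
Qed.

(* The upper gradient [+oo] on a Borel null set hides the curves which spend
   positive time there. *)
Lemma ae_eq_continuous_quasi_everywhere (u : T -> \bar R) (v : T -> R) :
  newton_space N u -> continuous v -> {ae mu, forall x, u x = (v x)%:E} ->
  newton_space N (EFin \o v) /\ quasi_everywhere N (fun x => u x = (v x)%:E).
Proof.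
have [c c1 qb] := N_qb.
move=> /newton_spaceP[mu_ Nu [g ug Ng]] cv [A [mA A0 uvA]].
(* Upper gradients have to be Borel, whereas [A] is only measurable; hence the Borel hull. *)
have [D [bD AD D0]] := mu_borel.2 _ mA; rewrite A0 in D0.
have mD := mu_borel.1 _ bD.
have uvD x : ~ D x -> u x = (v x)%:E.
  by move=> Dx; apply: contrapT => uvx; apply: Dx; apply: AD; exact: uvA.
have mg := upper_gradient_measurable ug; have [bg g0 gP] := ug.
pose h x : \bar R := ((\1_D x)%:E * +oo)%E.
have bh : measurable_fun [set: borelT] h.
  apply: emeasurable_funM => //; apply/measurable_EFinP.
  exact: (@measurable_indic _ borelT).
have mh := borel_measurable_fun bh.
have h0 x : (0 <= h x)%E by rewrite mule_ge0// lee_fin.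
have Nh : N h = 0 by exact: lattice_null.
have mv : measurable_fun setT (EFin \o v).
  by apply/measurable_EFinP; exact: continuous_measurable_funT.
have c0 : (0 <= c%:E)%E by rewrite lee_fin (le_trans ler01).
have Ng0 : (0 <= N g)%E := qb_ge0 qb mg.
have Nkgh (k : R) : 0 <= k -> (N (fun x => k%:E * g x + h x) <= (c * k)%:E * N g)%E.
  move=> k0; apply: (le_trans (qb_triangle qb _ mh)).
    exact: emeasurable_funM.
  by rewrite (qb_homogeneous qb)// Nh adde0 ger0_norm// muleA EFinM.
(* As [k > 0], a finite integral of [k g + h] forces a finite integral of [g + h], the form used by
   [upper_gradient_endpoints]. *)
have endpoints (k : R) l (gamma : R -> T) : 0 < k -> arclength_curve l gamma ->
    (\int[lebesgue_measure]_(t in `[0%R, l]) (k%:E * g (gamma t) + h (gamma t))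
       < +oo)%E ->
    u (gamma 0) = (v (gamma 0))%:E /\ u (gamma l) = (v (gamma l))%:E.
  move=> k0 lg ioo; apply: (upper_gradient_endpoints ug cv bD uvD lg).
  have mgg := arclength_measurable_comp lg bg.
  have mhg := arclength_measurable_comp lg bh.
  rewrite ge0_integralD// in ioo; last 2 first.
  - by move=> t _; rewrite mule_ge0// lee_fin ltW.
  - exact: emeasurable_funM.
  rewrite ge0_integralZl// ?lee_fin ?(ltW k0)// in ioo.
  rewrite ge0_integralD//; apply: lte_add_pinfty.
    rewrite ltNge leye_eq; apply/eqP => ig; move: ioo.
    by rewrite ig gt0_muley ?lte_fin// addye ?ltxx// -ltNye (lt_le_trans _ (integral_ge0 _ _)).
  apply: le_lt_trans ioo; rewrite leeDr//.
  by apply: mule_ge0; [rewrite lee_fin ltW|exact: integral_ge0].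
(* When the integral is infinite there is nothing to prove, so [w] is only tested on curves at whose
   endpoints [u] and [v] agree. *)
have ugk (k : R) (w : T -> \bar R) : 0 < k ->
    (forall l (gamma : R -> T), arclength_curve l gamma ->
      u (gamma 0) = (v (gamma 0))%:E -> u (gamma l) = (v (gamma l))%:E ->
      (`|w (gamma 0%R) - w (gamma l)| <=
       \int[lebesgue_measure]_(t in `[0%R, l]) (k%:E * g (gamma t) + h (gamma t)))%E) ->
    upper_gradient w (fun x => k%:E * g x + h x)%E.
  move=> k0 wP; split.
  - by apply: emeasurable_funD => //; exact: emeasurable_funM.
  - by move=> x; rewrite adde_ge0// mule_ge0// lee_fin ltW.
  move=> l gamma lg; have [ioo|] := ltP (\int[lebesgue_measure]_(t in
      `[0%R, l]) (k%:E * g (gamma t) + h (gamma t)))%E +oo%E.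
    by have [u0 ul] := endpoints k l gamma k0 lg ioo; exact: wP.
  by rewrite leye_eq => /eqP ->; rewrite leey.
split.
  apply/newton_spaceP; split => //.
    apply: le_lt_trans Nu; apply: (qb_lattice qb) => //.
    by exists A; split => // x /= h'; apply: uvA => /= uv; apply: h'; rewrite uv.
  exists (fun x => 1%:E * g x + h x)%E; last first.
    apply: (le_lt_trans (Nkgh 1 ler01)); rewrite mulr1.
    by rewrite lte_mul_pinfty// fin_numE.
  apply: ugk => // l gamma lg u0 ul.
  have := gP _ _ lg; rewrite u0 ul => /le_trans; apply.
  apply: ge0_le_integral => //.
  - exact: (arclength_measurable_comp lg bg).
  - exact: (arclength_measurable_comp lg (emeasurable_funD
      (emeasurable_funM (measurable_cst _) bg) bh)).
  - by move=> t _; rewrite mul1e leeDl.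
have mE : measurable [set x | u x <> (v x)%:E].
  have -> : [set x | u x <> (v x)%:E] = ~` [set x | u x = (v x)%:E] by [].
  apply: measurableC; rewrite -[X in measurable X]setTI.
  exact: emeasurable_fun_eq.
(* Admissible for the capacity and of quasi-norm 0. It vanishes at both ends of every curve that
   remains to be tested, which lets [k] be arbitrarily small. *)
pose w x : \bar R := (\1_[set x | u x <> (v x)%:E] x)%:E.
have mw : measurable_fun setT w.
  by apply/measurable_EFinP; exact: measurable_indic.
have Nw : N w = 0.
  apply/(qb_eq0 qb) => //; exists A; split => // x /= wx; apply: uvA => /= uvx.
  by apply: wx; rewrite /w indicE memNset//; apply.
have cap_le (k : R) : 0 < k -> (capacity N [set x | u x <> (v x)%:E] <= (c * k)%:E * N g)%E.
  move=> k0; apply: (@le_trans _ _ (newton_norm N w)).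
    apply: ereal_inf_lbound; exists w => //; split => // x uvx.
    by rewrite /w indicE mem_set.
  rewrite /newton_norm Nw add0e; apply: (le_trans _ (Nkgh k (ltW k0))).
  apply: ereal_inf_lbound; exists (fun x => k%:E * g x + h x)%E => //.
  apply: ugk => // l gamma lg u0 ul.
  rewrite /w !indicE !memNset/= ?subrr ?normr0//.
  by apply: integral_ge0 => t _; rewrite adde_ge0// mule_ge0// lee_fin ltW.
rewrite /quasi_everywhere; apply/eqP; rewrite eq_le; apply/andP; split; last first.
  apply: le_ereal_inf_tmp => _ [f [mf _] <-]; rewrite /newton_norm adde_ge0//.
    exact: (qb_ge0 qb).
  apply: le_ereal_inf_tmp => _ [f' uf <-].
  exact: (qb_ge0 qb (upper_gradient_measurable uf)).
have Ngf : N g \is a fin_num by rewrite ge0_fin_numE.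
apply/lee_addgt0Pr => e e0; rewrite add0e.
have c0' : 0 < c by rewrite (lt_le_trans ltr01).
(* The [+ 1] keeps the divisor positive even if [N g = 0]. *)
have M0 : 0 < c * (fine (N g) + 1) by rewrite mulr_gt0// ltr_wpDl// fine_ge0.
apply: (le_trans (cap_le (e / (c * (fine (N g) + 1))) _)); first by rewrite divr_gt0.
rewrite -(fineK Ngf) -EFinM lee_fin fineK//.
have -> : c * (e / (c * (fine (N g) + 1))) * fine (N g) =
    e * (c * fine (N g) / (c * (fine (N g) + 1))) by ring.
rewrite ler_piMr ?(ltW e0)// ler_pdivrMr// mul1r.
by rewrite ler_wpM2l ?(ltW c0')// lerDl.
Qed.

End newtonian_representatives.

(** * Rearrangements and level sets *)

Section level_sets.
Local Open Scope ereal_scope.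
Context {R : realType} {d : measure_display} {T : measurableType d}.
Variable mu : {measure set T -> \bar R}.
Implicit Types (f : T -> \bar R) (A E : set T).

Lemma nneseries_ge_term (u : (\bar R)^nat) n : (forall k, 0 <= u k) ->
  u n <= \sum_(k <oo) u k.
Proof.
move=> u0; apply: (le_trans _ (nneseries_lim_ge n.+1 _)) => //.
by rewrite big_nat_recr//= leeDr// sume_ge0.
Qed.

(** Points of [A] are sorted by the first level that dominates [f]. If it is [b 0], the first term
    pays. If it is [b m.+1], the point lies above [b m], in a set of measure at most [t m]. Points
    above every level form a null set because [t] tends to 0. *)
Lemma integral_powR_level_sets A f (p : R) (b t : nat -> R) :
  measurable A -> measurable_fun [set: T] f -> (forall x, 0 <= f x) ->
  (0 <= p)%R -> (forall j, (0 <= b j)%R) -> (forall j, (0 <= t j)%R) ->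
  t @ \oo --> 0%R ->
  (forall j, mu (A `&` [set x | (b j)%:E < f x]) <= (t j)%:E) ->
  \int[mu]_(x in A) f x `^ p <=
    mu A * (b 0%N `^ p)%:E + \sum_(j <oo) (t j * b j.+1 `^ p)%:E.
Proof.
move=> mA mf f0 p0 b0 t0 tcvg mub.
pose S j := A `&` [set x | (b j)%:E < f x].
have mS j : measurable (S j).
  apply: measurableI => //; rewrite -[X in measurable X]setTI.
  exact: emeasurable_fun_o_infty.
pose Z := \bigcap_j S j.
have mZ : measurable Z by exact: bigcap_measurable.
have muZ : mu Z = 0.
  apply/eqP; rewrite eq_le measure_ge0 andbT.
  have Zt j : mu Z <= (t j)%:E.
    apply: (le_trans _ (mub j)); apply: le_measure; rewrite ?inE//.
      exact: mS.
    by move=> x; apply.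
  apply/lee_addgt0Pr => e e0; rewrite add0e.
  have /cvgrPdist_lt/(_ _ e0)[n _ /(_ n (leqnn n))] := tcvg.
  rewrite sub0r normrN ger0_norm// => tne.
  by rewrite (le_trans (Zt n))// lee_fin ltW.
pose F x : \bar R := (b 0%N `^ p)%:E + \sum_(j <oo) (b j.+1 `^ p)%:E * (\1_(S j) x)%:E.
have F0 j x : 0 <= (b j.+1 `^ p)%:E * (\1_(S j) x)%:E.
  by rewrite mule_ge0// lee_fin powR_ge0.
have mFj j : measurable_fun [set: T] (fun x => (b j.+1 `^ p)%:E * (\1_(S j) x)%:E).
  apply: emeasurable_funM => //; apply/measurable_EFinP.
  exact: measurable_indic.
have mF : measurable_fun [set: T] F.
  apply: emeasurable_funD => //.
  exact: ge0_emeasurable_sum.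
apply: (@le_trans _ _ (\int[mu]_(x in A) F x)).
  apply: ae_ge0_le_integral => //.
  - by move=> x _; exact: poweR_ge0.
  - by apply: measurable_funTS; apply: (measurableT_comp (measurable_poweR _)).
  - move=> x _; rewrite adde_ge0// ?lee_fin ?powR_ge0//.
    exact: nneseries_ge0.
  - exact: measurable_funTS.
  exists Z; split => // x /= /not_implyP[Ax fF] j _; split => //=.
  rewrite ltNge; apply/negP => fb; apply: fF.
  have exj : exists j, f x <= (b j)%:E by exists j.
  case: (ex_minnP exj) => -[|m] fbm mmin.
    rewrite /F -[leLHS]adde0; apply: leeD; last exact: nneseries_ge0.
    rewrite -poweR_EFin gt0_ler_poweR//; first by rewrite in_itv/= f0 leey.
    by rewrite in_itv/= lee_fin b0 leey.
  rewrite /F -[leLHS]add0e; apply: leeD; first by rewrite lee_fin powR_ge0.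
  apply: (le_trans _ (nneseries_ge_term m (F0 ^~ x))).
  rewrite indicE mem_set ?mule1.
    rewrite -poweR_EFin gt0_ler_poweR//; first by rewrite in_itv/= f0 leey.
    by rewrite in_itv/= lee_fin b0 leey.
  split => //=; rewrite ltNge; apply/negP => /mmin; by rewrite ltnn.
rewrite ge0_integralD//; last 3 first.
- by move=> x _; rewrite lee_fin powR_ge0.
- by move=> x _; exact: nneseries_ge0.
- by apply: measurable_funTS; exact: ge0_emeasurable_sum.
rewrite integral_cst// muleC leeD2l//.
rewrite integral_nneseries//; last first.
  by move=> n; exact: measurable_funTS.
apply: lee_nneseries => [j _ _|j _]; first by apply: integral_ge0.
rewrite ge0_integralZl_EFin//; last 2 first.
- by apply: measurable_funTS; apply/measurable_EFinP; exact: measurable_indic.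
- exact: powR_ge0.
rewrite integral_indic// mulrC EFinM lee_wpmul2l ?lee_fin ?powR_ge0//.
apply: (le_trans _ (mub j)); apply: le_measure; rewrite ?inE//.
- by apply: measurableI => //; exact: mS.
- exact: mS.
Qed.

End level_sets.

Section rearrangement.
Local Open Scope ereal_scope.
Context {R : realType} {d : measure_display} {T : metricMeasurableType d R}.
Variable mu : {measure set T -> \bar R}.
Implicit Types (f : T -> \bar R).

Lemma rearrangement_ge0 f t : 0 <= rearrangement mu f t.
Proof. by apply: le_ereal_inf_tmp => _ [r [r0 _] <-]; rewrite lee_fin. Qed.

Lemma rearrangement_nonincreasing f t t' : (t <= t')%R ->
  rearrangement mu f t' <= rearrangement mu f t.
Proof.
move=> tt'; apply: ereal_inf_le_tmp => _ [r [r0 rt] <-]; exists r => //; split => //.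
by rewrite (le_trans rt)// lee_fin.
Qed.

(** By monotonicity the superlevel sets are intervals. *)
Lemma measurable_rearrangement f : measurable_fun setT (rearrangement mu f).
Proof.
apply: (measurability _ (ErealGenOInfty.measurableE R)).
move=> /= _ [_ [a ->]] <-; apply: measurableI => //.
apply: is_interval_measurable => x y /=; rewrite !in_itv/= !andbT => ax ay z /andP[_ zy].
by rewrite in_itv/= andbT; apply: (lt_le_trans ay); exact: rearrangement_nonincreasing.
Qed.

(** The infimum defining the rearrangement is attained: the level set is the increasing union of
    those at heights [b + 1/(n+1)], each of measure at most [t]. *)
Lemma mu_gt_rearrangement f t (b : R) : measurable_fun setT f -> (0 <= t)%R ->
  rearrangement mu f t = b%:E -> mu [set x | b%:E < `|f x|] <= t%:E.
Proof.
move=> mf t0 fb.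
have mS (r : R) : measurable [set x | r%:E < `|f x|].
  rewrite -[X in measurable X]setTI; apply: emeasurable_fun_o_infty => //.
  exact: measurableT_comp.
pose S n := [set x | (b + n.+1%:R^-1)%:E < `|f x|].
have -> : [set x | b%:E < `|f x|] = \bigcup_n S n.
  apply/seteqP; split => x /=; last first.
    by move=> [n _]; apply: lt_trans; rewrite lte_fin ltrDl invr_gt0.
  rewrite /bigcup/S/=; case: (`|f x|) => // [y|_]; last by exists 0%N; rewrite ?ltry.
  by rewrite lte_fin => /ltr_add_invr[n ?]; exists n; rewrite // lte_fin.
have cvgS : mu (S n) @[n --> \oo] --> mu (\bigcup_n S n).
  apply: nondecreasing_cvg_mu; first by move=> n; exact: mS.
    by apply: bigcupT_measurable => n; exact: mS.
  move=> m n mn; apply/subsetPset => x; apply: le_lt_trans.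
  by rewrite lee_fin lerD2l lef_pV2 ?posrE// ler_nat.
have Sn n : mu (S n) <= t%:E.
  have : rearrangement mu f t < (b + n.+1%:R^-1)%:E.
    by rewrite fb lte_fin ltrDl invr_gt0.
  move=> /ereal_inf_lt[_ [r [r0 rt] <-] rb].
  apply: (le_trans _ rt); apply: le_measure; rewrite ?inE; try exact: mS.
  by move=> x; apply: lt_trans.
rewrite -(cvg_lim _ cvgS)//; apply: lime_le; first by apply/cvg_ex; eexists; exact: cvgS.
exact: nearW.
Qed.

End rearrangement.

(** * Dyadic series *)

Section dyadic_series.
Local Open Scope ereal_scope.
Context {R : realType}.
Implicit Types (p q s alpha theta : R) (b : nat -> R).

Lemma nneseries_le_bound (u : (\bar R)^nat) (C : \bar R) : (forall k, 0 <= u k) ->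
  (forall n, \sum_(0 <= k < n) u k <= C) -> \sum_(k <oo) u k <= C.
Proof.
by move=> u0 uC; apply: lime_le; [exact: is_cvg_nneseries|exact: nearW].
Qed.

Lemma geometric_nneseries_lty theta : (0 < theta < 1)%R ->
  \sum_(k <oo) (theta ^+ k)%:E < +oo.
Proof.
move=> /andP[t0 t1].
apply: (@le_lt_trans _ _ ((1 - theta)^-1)%:E); last exact: ltry.
apply: nneseries_le_bound => [k|n]; first by rewrite lee_fin exprn_ge0// ltW.
rewrite sumEFin lee_fin; have := geometric_le_lim n ler01 t0.
rewrite ger0_norm ?(ltW t0)// mul1r => /(_ t1); apply: le_trans.
by rewrite /series/= ler_sum// => k _; rewrite mul1r.
Qed.

(** Condensation: pairing consecutive terms gives [S (2n+1) <= 1 + theta * S n] with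
    [theta = 2^(1-alpha) < 1]. As [S n <= S (2n+1)], all partial sums are at most
    [1 / (1 - theta)]. *)
Lemma riemann_nneseries_lty alpha : (1 < alpha)%R ->
  \sum_(k <oo) (k.+1%:R `^ (- alpha))%R%:E < +oo.
Proof.
move=> a1; pose f k : R := (k.+1%:R `^ (- alpha))%R.
pose S n := (\sum_(0 <= k < n) f k)%R.
pose theta : R := (2 * 2 `^ (- alpha))%R.
have f0 k : (0 <= f k)%R by exact: powR_ge0.
have theta1 : (theta < 1)%R.
  rewrite /theta powRN ltr_pdivrMr ?powR_gt0// mul1r.
  rewrite /powR gt_eqF// -[ltLHS]lnK ?posrE// ltr_expR ltr_pMl//.
  by rewrite ln_gt0// ltr1n.
have f2 n : (f n.*2.+1 = 2 `^ (- alpha) * f n)%R.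
  rewrite /f -powRM// -natrM; congr (_%:R `^ _)%R; lia.
have fS n : (f n.+1 <= f n)%R.
  rewrite /f !powRN lef_pV2 ?posrE ?powR_gt0//.
  by rewrite ge0_ler_powR ?nnegrE ?ler_nat// ltW// (lt_trans ltr01).
have S2 n : (S n.*2.+1 <= 1 + theta * S n)%R.
  elim: n => [|n ih].
    by rewrite /S big_nat1 big_geq// mulr0 addr0 /f powR1.
  rewrite doubleS /S big_nat_recr// big_nat_recr//= -/(S n.*2.+1).
  rewrite [in leRHS]big_nat_recr//= -/(S n) mulrDr addrA -[leLHS]addrA lerD//.
  by rewrite /theta -mulrA -f2 mulr2n mulrDl !mul1r lerD2l.
apply: (@le_lt_trans _ _ ((1 - theta)^-1)%:E); last exact: ltry.
apply: nneseries_le_bound => [k|n]; first by rewrite lee_fin.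
rewrite sumEFin lee_fin -/(S n) -[leRHS]mul1r ler_pdivlMr ?subr_gt0//.
rewrite mulrBr mulr1 lerBlDr [(S n * _)%R]mulrC (le_trans _ (S2 n))//.
rewrite /S (@big_cat_nat _ _ _ n 0 n.*2.+1)//=; last lia.
by rewrite lerDl sumr_ge0.
Qed.

(** For finite values, x^p = x x^(p-1), and x^(p-1) and y^(p-1) are both at most (x + y)^(p-1) since
    p >= 1. *)
Lemma poweR_superadditive p (x y : \bar R) : (1 <= p)%R -> 0 <= x -> 0 <= y ->
  x `^ p + y `^ p <= (x + y) `^ p.
Proof.
move=> p1; have pp : (0 < p)%R by exact: lt_le_trans p1.
case: x y => [a| |] [c| |] // a0 c0.
- move: c0 a0; rewrite !lee_fin => c0 a0.
  suff : (a `^ p + c `^ p <= (a + c) `^ p)%R by rewrite -lee_fin.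
  rewrite -!(mulr_powRB1 _ pp) ?addr_ge0// mulrDl lerD// ler_wpM2l//
    ge0_ler_powR ?nnegrE ?subr_ge0 ?addr_ge0//.
    by rewrite lerDl.
  by rewrite lerDr.
- by rewrite !addey// poweRyr ?gt_eqF// leey.
- by rewrite !addye// poweRyr ?gt_eqF// leey.
- by rewrite !addye// poweRyr ?gt_eqF// leey.
Qed.

Lemma nneseries_poweR_superadditive p (y : nat -> \bar R) : (1 <= p)%R ->
  (forall j, 0 <= y j) -> \sum_(j <oo) y j `^ p <= (\sum_(j <oo) y j) `^ p.
Proof.
move=> p1 y0; have p0 : (0 <= p)%R by exact: le_trans p1.
apply: nneseries_le_bound => [k|n]; first exact: poweR_ge0.
apply: (@le_trans _ _ ((\sum_(0 <= j < n) y j) `^ p)); last first.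
  rewrite gt0_ler_poweR// ?in_itv/= ?leey ?andbT.
  - exact: sume_ge0.
  - exact: nneseries_ge0.
  - exact: nneseries_lim_ge.
elim: n => [|n ih]; first by rewrite !big_geq//; exact: poweR_ge0.
rewrite !big_nat_recr//=; apply: (le_trans (leeD ih (lexx _))).
by apply: (poweR_superadditive p1) => //; exact: sume_ge0.
Qed.

(* [tail_mean q p b k] bounds, up to a constant, the mean of [f `^ p] over a
   set of measure at least [q ^+ k] when [b j] is the rearrangement of [f] at
   [q ^+ j]. *)
Definition tail_mean q p b k : \bar R := \sum_(j <oo) (q ^+ j * b (k + j)%N `^ p)%:E.

(** Superadditivity of the p-th power bounds the root of the tail mean by the sum over j of q^(j/p)
    b_(k+j). Multiplied by q^(k/s), each term becomes theta^j times the Lorentz term of index k + j,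
    where theta = q^(1/p - 1/s) < 1 because p < s. Exchanging the sums leaves a geometric series. *)
Lemma tail_mean_lorentz q p s b : (0 < q < 1)%R -> (1 <= p < s)%R ->
  (forall j, (0 <= b j)%R) -> \sum_(j <oo) (b j * q `^ (j%:R / s))%:E < +oo ->
  \sum_(k <oo) (q `^ (k%:R / s))%R%:E * tail_mean q p b k `^ p^-1 < +oo.
Proof.
move=> /andP[q0 q1] /andP[p1 ps] b0 bs.
have p0 : (0 < p)%R by exact: lt_le_trans p1.
have s0 : (0 < s)%R by exact: lt_trans ps.
pose theta := (q `^ (p^-1 - s^-1))%R.
have theta01 : (0 < theta < 1)%R.
  rewrite powR_gt0//= /theta.
  have := @gt0_ltr_powR _ (p^-1 - s^-1) _ q 1%R.
  by rewrite powR1 subr_gt0 ltf_pV2 ?posrE ?nnegrE// => /(_ ps (ltW q0) ler01 q1).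
pose beta j := (b j * q `^ (j%:R / s))%:E.
have beta0 j : 0 <= beta j by rewrite lee_fin mulr_ge0// powR_ge0.
have th0 j : (0 <= theta ^+ j)%R by rewrite exprn_ge0// ltW//; case/andP: theta01.
apply: (@le_lt_trans _ _ (\sum_(j <oo) (theta ^+ j)%:E * \sum_(k <oo) beta k)).
  apply: (@le_trans _ _ (\sum_(k <oo) \sum_(j <oo) (theta ^+ j)%:E * beta (j + k)%N)).
    apply: lee_nneseries => [k _ _|k _]; first by rewrite mule_ge0 ?poweR_ge0// lee_fin powR_ge0.
    pose y j := (q `^ (j%:R / p) * b (k + j)%N)%:E.
    have y0 j : 0 <= y j by rewrite lee_fin mulr_ge0// powR_ge0.
    apply: (@le_trans _ _ ((q `^ (k%:R / s))%R%:E * \sum_(j <oo) y j)).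
      apply: lee_wpmul2l; first by rewrite lee_fin powR_ge0.
      have -> : \sum_(j <oo) y j = ((\sum_(j <oo) y j) `^ p) `^ p^-1.
        by rewrite -poweRrM mulfV ?gt_eqF// poweRe1// nneseries_ge0.
      rewrite gt0_ler_poweR// ?in_itv/= ?leey ?andbT ?invr_ge0 ?(ltW p0)//.
      - by apply: nneseries_ge0 => *; rewrite lee_fin mulr_ge0 ?powR_ge0// exprn_ge0// ltW.
      - exact: poweR_ge0.
      apply: le_trans (nneseries_poweR_superadditive p1 y0).
      apply: lee_nneseries => [j _ _|j _].
        by rewrite lee_fin mulr_ge0 ?powR_ge0// exprn_ge0// ltW.
      rewrite poweR_EFin powRM ?powR_ge0// -powRrM mulfVK ?gt_eqF//.
      by rewrite powR_mulrn// ltW.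
    rewrite -nneseriesZl//; apply: lee_nneseries => [j _ _|j _].
      by rewrite mule_ge0// lee_fin powR_ge0.
    have E : (theta ^+ j * q `^ ((j + k)%N%:R / s) =
              q `^ (k%:R / s) * q `^ (j%:R / p))%R.
      rewrite /theta -powR_mulrn ?powR_ge0// -powRrM.
      rewrite -!powRD ?(gt_eqF q0) ?implybT//.
      by congr (_ `^ _)%R; rewrite natrD; ring.
    rewrite /y /beta -!EFinM lee_fin mulrA -E (addnC k).
    by rewrite [leRHS]mulrCA [leRHS]mulrC.
  rewrite nneseries_interchange; last by move=> *; rewrite mule_ge0// lee_fin.
  apply: lee_nneseries => [j _ _|j _].
    by apply: nneseries_ge0 => *; rewrite mule_ge0// lee_fin.
  rewrite nneseriesZl//; apply: lee_wpmul2l; first by rewrite lee_fin.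
  under eq_eseriesr do rewrite addnC.
  rewrite nneseries_addn// [leRHS](nneseries_split 0 j)// add0n leeDr// sume_ge0//.
have B0 : 0 <= \sum_(k <oo) beta k by exact: nneseries_ge0.
have Bf : \sum_(k <oo) beta k \is a fin_num by rewrite ge0_fin_numE.
rewrite -(fineK Bf); under eq_eseriesr do rewrite muleC.
rewrite nneseriesZl; last by move=> *; rewrite lee_fin.
rewrite lte_mul_pinfty ?lee_fin ?fine_ge0//.
exact: geometric_nneseries_lty.
Qed.

(** Every index k + j of the tail carries a weight of at least (k+1)^(alpha s), so q^k times the
    tail mean is at most W (k+1)^(-alpha s). The s-th root decays like (k+1)^(-alpha), which is
    summable. *)
Lemma tail_mean_zygmund q s alpha b : (0 < q < 1)%R -> (0 < s)%R -> (1 < alpha)%R ->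
  (forall j, (0 <= b j)%R) ->
  \sum_(j <oo) (q ^+ j * (b j * j.+1%:R `^ alpha) `^ s)%:E < +oo ->
  \sum_(k <oo) (q `^ (k%:R / s))%R%:E * tail_mean q s b k `^ s^-1 < +oo.
Proof.
move=> /andP[q0 q1] s0 a1 b0 bs.
have a0 : (0 <= alpha)%R by rewrite ltW// (lt_trans _ a1).
pose w j := (q ^+ j * (b j * j.+1%:R `^ alpha) `^ s)%R.
have w0 j : (0 <= w j)%R by rewrite mulr_ge0 ?powR_ge0// exprn_ge0// ltW.
pose W := \sum_(j <oo) (w j)%:E; have Woo : W < +oo := bs.
have W0 : 0 <= W by apply: nneseries_ge0 => *; rewrite lee_fin.
have H0 k j : 0 <= (q ^+ j * b (k + j)%N `^ s)%:E.
  by rewrite lee_fin mulr_ge0 ?powR_ge0// exprn_ge0// ltW.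
apply: (@le_lt_trans _ _ (\sum_(k <oo) W `^ s^-1 * (k.+1%:R `^ (- alpha))%R%:E)); last first.
  have Wf : W `^ s^-1 \is a fin_num by rewrite fin_num_poweR// ge0_fin_numE.
  rewrite -(fineK Wf) nneseriesZl; last by move=> *; rewrite lee_fin powR_ge0.
  rewrite lte_mul_pinfty ?lee_fin ?fine_ge0 ?poweR_ge0//.
  exact: riemann_nneseries_lty.
apply: lee_nneseries => [k _ _|k _]; first by rewrite mule_ge0 ?poweR_ge0// lee_fin powR_ge0.
have -> : (k.+1%:R `^ (- alpha))%R%:E = ((k.+1%:R `^ (- (alpha * s)))%R%:E `^ s^-1) :> \bar R.
  by rewrite poweR_EFin -powRrM mulNr mulfK// gt_eqF.
have -> : (q `^ (k%:R / s))%R%:E = (q ^+ k)%:E `^ s^-1.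
  by rewrite poweR_EFin -powR_mulrn ?(ltW q0)// -powRrM.
rewrite -!poweRM ?lee_fin ?powR_ge0 ?exprn_ge0 ?(ltW q0)//; last exact: nneseries_ge0.
rewrite gt0_ler_poweR// ?in_itv/= ?leey ?andbT ?invr_ge0 ?(ltW s0)//.
- by rewrite mule_ge0 ?lee_fin ?exprn_ge0 ?(ltW q0)//; exact: nneseries_ge0.
- by rewrite mule_ge0// lee_fin powR_ge0.
rewrite -nneseriesZl// muleC.
apply: (@le_trans _ _ ((k.+1%:R `^ (- (alpha * s)))%R%:E *
    \sum_(j <oo) (w (j + k)%N)%:E)); last first.
  apply: lee_wpmul2l; first by rewrite lee_fin powR_ge0.
  rewrite (nneseries_addn (f := fun j => (w j)%:E)); last by move=> *; rewrite lee_fin.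
  rewrite /W [leRHS](nneseries_split 0 k) ?add0n; last by move=> *; rewrite lee_fin.
  by rewrite leeDr// sume_ge0// => *; rewrite lee_fin.
rewrite -nneseriesZl; last by move=> *; rewrite lee_fin.
apply: lee_nneseries => [j _ _|j _]; first by rewrite mule_ge0// lee_fin exprn_ge0// ltW.
rewrite -!EFinM lee_fin /w (addnC j) exprD -!mulrA [leRHS]mulrCA.
rewrite ler_wpM2l ?exprn_ge0 ?(ltW q0)// [leRHS]mulrCA.
rewrite ler_wpM2l ?exprn_ge0 ?(ltW q0)// powRM ?powR_ge0// mulrCA.
rewrite ler_peMr ?powR_ge0// powRN -powRrM ler_pdivlMl ?powR_gt0// mulr1.
by rewrite ge0_ler_powR ?nnegrE ?ler_nat ?mulr_ge0 ?(ltW s0)// ltnS leq_addr.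
Qed.

(** With exponent 1 the root disappears and the sums can be exchanged: the term [x m] occurs once
    for each k <= m, and [m + 1] is at most the weight (m+1)^alpha. *)
Lemma tail_mean_zygmund1 q alpha b : (0 < q < 1)%R -> (1 <= alpha)%R ->
  (forall j, (0 <= b j)%R) ->
  \sum_(j <oo) (q ^+ j * (b j * j.+1%:R `^ alpha) `^ 1)%:E < +oo ->
  \sum_(k <oo) (q `^ (k%:R / 1))%R%:E * tail_mean q 1 b k `^ 1^-1 < +oo.
Proof.
move=> /andP[q0 q1] a1 b0; apply: le_lt_trans.
pose x j := (q ^+ j * b j)%:E.
have x0 j : 0 <= x j by rewrite lee_fin mulr_ge0// exprn_ge0// ltW.
have -> : \sum_(k <oo) (q `^ (k%:R / 1))%R%:E * tail_mean q 1 b k `^ 1^-1 =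
    \sum_(k <oo) \sum_(m <oo) (if (k <= m)%N then x m else 0).
  apply: eq_eseriesr => k _; rewrite invr1 poweRe1; last first.
    by apply: nneseries_ge0 => *; rewrite lee_fin mulr_ge0 ?powR_ge0// exprn_ge0// ltW.
  rewrite mulr1 powR_mulrn ?(ltW q0)// -nneseriesZl; last first.
    by move=> *; rewrite lee_fin mulr_ge0 ?powR_ge0// exprn_ge0// ltW.
  transitivity (\sum_(j <oo) x (j + k)%N).
    apply: eq_eseriesr => j _; rewrite /x -EFinM addnC powRr1//.
    by rewrite exprD mulrCA mulrA.
  rewrite nneseries_addn// [RHS](nneseries_split 0 k) ?add0n; last first.
    by move=> *; case: ifP.
  rewrite big_nat big1 ?add0e; last by move=> i /= ik; rewrite leqNgt ik.
  rewrite [RHS]eseries_cond [LHS]eseries_cond; apply: eq_eseriesr => i.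
  by move=> /= ->.
rewrite nneseries_interchange; last by move=> *; case: ifP.
apply: lee_nneseries => [m _ _|m _].
  by apply: nneseries_ge0 => *; case: ifP.
apply: nneseries_le_bound => [k|n]; first by case: ifP.
have -> : \sum_(0 <= k < n) (if (k <= m)%N then x m else 0) =
    ((q ^+ m * b m) *+ minn n m.+1)%:E.
  elim: n => [|n ih]; first by rewrite big_geq// min0n.
  rewrite big_nat_recr//= ih /x; case: (leqP n m) => nm.
    by rewrite (minn_idPl _) ?(leqW nm)// (minn_idPl _)// -EFinD mulrSr.
  by rewrite (minn_idPr _)// (minn_idPr _) ?(leqW nm)// adde0.
rewrite lee_fin powRr1 ?mulr_ge0 ?powR_ge0// mulrA -[leLHS]mulr_natr.
rewrite ler_wpM2l ?mulr_ge0 ?exprn_ge0 ?(ltW q0)//.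
apply: (@le_trans _ _ m.+1%:R); first by rewrite ler_nat geq_minr.
by apply: le1r_powR => //; rewrite ler1n.
Qed.

End dyadic_series.

(** * Dyadic sampling of the Zygmund and Lorentz norms *)

Section dyadic_integrals.
Local Open Scope ereal_scope.
Context {R : realType} {d : measure_display} {T : metricMeasurableType d R}.
Variable mu : {measure set T -> \bar R}.

(** A lower sum over disjoint intervals. They are open so as to stay inside an open domain even when
    [t 0] is its right end. *)
Lemma series_le_integral (D : set R) (phi : R -> \bar R) (w : nat -> \bar R)
    (t : nat -> R) :
  measurable D -> measurable_fun D phi -> (forall x, D x -> 0 <= phi x) ->
  (forall i j, (i <= j)%N -> (t j <= t i)%R) ->
  (forall j, `]t j.+1, t j[ `<=` D) ->
  (forall j, 0 <= w j) -> (forall j x, x \in `]t j.+1, t j[%R -> w j <= phi x) ->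
  \sum_(j <oo) w j * (t j - t j.+1)%:E <= \int[lebesgue_measure]_(x in D) phi x.
Proof.
move=> mD mphi phi0 tmono tD w0 wphi.
pose F j : set R := `]t j.+1, t j[%classic.
have mF j : measurable (F j) by exact: measurable_itv.
have lF j : lebesgue_measure (F j) = (t j - t j.+1)%:E.
  rewrite lebesgue_measure_itv/= lte_fin; case: ltP => // tj.
  have : (t j.+1 <= t j)%R by exact: tmono.
  move=> tj'; have -> : t j = t j.+1 by apply/eqP; rewrite eq_le tj tj'.
  by rewrite subrr.
have tF : trivIset setT F.
  apply: ltn_trivIset => i j ij; apply/seteqP; split => // x [/=].
  rewrite /F /= !in_itv/= => /andP[xi _] /andP[_ xj].
  have := tmono _ _ ij; rewrite leNgt => /negP; apply.
  exact: lt_trans xi xj.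
have FD : \bigcup_j F j `<=` D by move=> x [j _]; exact: tD.
apply: (@le_trans _ _ (\int[lebesgue_measure]_(x in \bigcup_j F j) phi x)); last first.
  apply: ge0_subset_integral => //; exact: bigcupT_measurable.
rewrite ge0_integral_bigcup//; last 2 first.
- by move: mphi; apply: measurable_funS.
- by move=> x /FD; exact: phi0.
apply: lee_nneseries => [j _ _|j _].
  by rewrite mule_ge0// lee_fin subr_ge0 tmono.
have -> : w j * (t j - t j.+1)%:E = \int[lebesgue_measure]_(x in F j) cst (w j) x.
  by rewrite integral_cst; [congr (_ * _); exact/esym/lF|exact: mF].
apply: ge0_le_integral.
- exact: mF.
- by move=> x _; exact: w0.
- exact: measurable_cst.
- by move: mphi; apply: measurable_funS => //; exact: tD.
- by move=> x xj; exact: wphi.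
Qed.

Lemma dyadic_open_itv (tau q : R) : (0 < tau)%R -> (0 < q < 1)%R ->
  (forall i j, (i <= j)%N -> (tau * q ^+ j <= tau * q ^+ i)%R) /\
  (forall j, 0 < tau * q ^+ j <= tau)%R.
Proof.
move=> tau0 /andP[q0 q1]; have mono i j : (i <= j)%N -> (tau * q ^+ j <= tau * q ^+ i)%R.
  by move=> ij; rewrite ler_wpM2l ?(ltW tau0)// ler_wiXn2l// ltW.
split=> // j; rewrite mulr_gt0 ?exprn_gt0//=.
by have := mono 0%N j (leq0n _); rewrite expr0 mulr1.
Qed.

Lemma pmule_lty (C : R) (x : \bar R) : (0 < C)%R -> C%:E * x < +oo -> 0 <= x -> x < +oo.
Proof.
by move=> C0; case: x => // [r _ _|]; rewrite ?ltry// gt0_muley ?lte_fin.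
Qed.

(** The weights are positive, so a single infinite sample would make the series infinite; the
    samples therefore form a real sequence. *)
Lemma rearrangement_dyadic_fin f (t : nat -> R) (c e : nat -> R) s :
  (0 < s)%R -> (forall j, (0 < c j)%R) -> (forall j, (0 < e j)%R) ->
  \sum_(j <oo) (e j)%:E * (rearrangement mu f (t j) * (c j)%:E) `^ s < +oo ->
  exists2 b : nat -> R, forall j, (0 <= b j)%R /\ rearrangement mu f (t j) = (b j)%:E &
    \sum_(j <oo) (e j * (b j * c j) `^ s)%:E < +oo.
Proof.
move=> s0 c0 e0 soo.
have r0 j : 0 <= rearrangement mu f (t j) by exact: rearrangement_ge0.
have rf j : rearrangement mu f (t j) = (fine (rearrangement mu f (t j)))%:E.
  rewrite fineK// ge0_fin_numE// ltNge leye_eq; apply/eqP => roo.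
  suff : +oo < +oo :> \bar R by rewrite ltxx.
  apply: le_lt_trans soo.
  apply: (le_trans _ (nneseries_ge_term j _)) => [|k]; last first.
    by rewrite mule_ge0 ?poweR_ge0// lee_fin ltW.
  by rewrite roo gt0_mulye ?lte_fin// poweRyr ?gt_eqF// gt0_muley ?lte_fin.
exists (fun j => fine (rearrangement mu f (t j))).
  by move=> j; split=> //; rewrite fine_ge0.
apply: le_lt_trans soo; apply: lee_nneseries => [j _ _|j _].
  by rewrite lee_fin mulr_ge0 ?powR_ge0// ltW.
by rewrite EFinM -poweR_EFin EFinM -rf.
Qed.

(** On the j-th interval the rearrangement is at least its value at the right end, the logarithmic
    factor is at least a multiple of j + 1, and the length is proportional to q^j. *)
Lemma zygmund_dyadic (s alpha : R) E f (tau q : R) : (0 < s)%R -> (0 <= alpha)%R ->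
  (0 < q < 1)%R -> (0 < tau)%R -> (tau <= fine (mu E))%R ->
  zygmund_norm mu s alpha E f < +oo ->
  exists2 b : nat -> R, forall j, (0 <= b j)%R /\
      rearrangement mu (f \_ E) (tau * q ^+ j) = (b j)%:E &
    \sum_(j <oo) (q ^+ j * (b j * j.+1%:R `^ alpha) `^ s)%:E < +oo.
Proof.
move=> s0 a0 q01 tau0 tauM; have /andP[q0 q1] := q01.
set M := fine (mu E) in tauM *.
have M0 : (0 < M)%R by exact: lt_le_trans tauM.
rewrite /zygmund_norm -/M => /lty_poweRy ioo.
have {}ioo := ioo (negbT (gt_eqF _)).
rewrite invr_gt0 in ioo; have {}ioo := ioo s0.
pose rho := rearrangement mu (f \_ E).
pose phi t := (rho t * ((1 + ln (M / t)) `^ alpha)%:E) `^ s.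
have [tmono tpos] := dyadic_open_itv tau0 q01.
(* For x < tau q^j the logarithmic factor is at least [1 + j * (- ln q)]; the minimum bounds both
   the 1 and the slope, giving [kappa * (j + 1)]. *)
pose kappa := (Num.min 1 (- ln q))%R.
have kappa0 : (0 < kappa)%R by rewrite lt_min ltr01 oppr_gt0 ln_lt0// q0.
pose w j := (rho (tau * q ^+ j)%R * ((kappa * j.+1%:R) `^ alpha)%:E) `^ s.
have mphi : measurable_fun `]0%R, M[%classic phi.
  apply: (measurableT_comp (measurable_poweR _)).
  apply: emeasurable_funM; first by apply: measurable_funTS; exact: measurable_rearrangement.
  apply/measurable_EFinP.
  apply: (@measurableT_comp _ _ _ _ _ _ (@powR R ^~ alpha)) => //.
  apply: measurable_funD => //.
  have : measurable_fun `]0%R, M[%classic (fun x : R => ln M - ln x)%R.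
    by apply: measurable_funB => //; apply: measurable_funTS; exact: measurable_ln.
  apply: eq_measurable_fun => x; rewrite inE/= in_itv/= => /andP[x0 _].
  by rewrite lnM ?posrE ?invr_gt0// lnV.
have key := @series_le_integral `]0%R, M[%classic phi w (fun j => tau * q ^+ j)%R.
have {}key : \sum_(j <oo) w j * (tau * q ^+ j - tau * q ^+ j.+1)%:E < +oo.
  apply: (le_lt_trans (key _ _ _ _ _ _ _)) => //.
  - by move=> x _; exact: poweR_ge0.
  - move=> j x; rewrite /= !in_itv/= => /andP[xj1 xj].
    by have := tpos j; have := tpos j.+1; lra.
  - by move=> j; exact: poweR_ge0.
  - move=> j x; rewrite in_itv/= => /andP[xj1 xj].
    have x0 : (0 < x)%R by have := tpos j.+1; lra.
    have lnx : (kappa * j.+1%:R <= 1 + ln (M / x))%R.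
      have lx : (- ln q *+ j <= ln (M / x))%R.
        rewrite -lnV ?posrE// -lnXn ?invr_gt0// ler_ln ?posrE ?exprn_gt0 ?invr_gt0 ?divr_gt0//.
        rewrite ler_pdivlMr// exprVn mulrC ler_pdivrMr ?exprn_gt0//.
        by rewrite (le_trans (ltW xj))// ler_wpM2r// exprn_ge0// ltW.
      rewrite -natr1 mulrDr mulr1 addrC lerD//; first by rewrite ge_min lexx.
      by apply: le_trans lx; rewrite mulr_natr lerMn2r ge_min lexx !orbT.
    apply: gt0_ler_poweR; rewrite ?(ltW s0)// ?in_itv/= ?leey ?andbT.
    + by rewrite mule_ge0 ?rearrangement_ge0// lee_fin powR_ge0.
    + by rewrite mule_ge0 ?rearrangement_ge0// lee_fin powR_ge0.
    apply: lee_pmul; rewrite ?rearrangement_ge0 ?lee_fin ?powR_ge0//.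
      by apply: rearrangement_nonincreasing; exact: ltW.
    have k1 : (0 <= kappa * j.+1%:R)%R by rewrite mulr_ge0// ltW.
    by rewrite ge0_ler_powR ?nnegrE// (le_trans k1).
apply: (@rearrangement_dyadic_fin _ (fun j => tau * q ^+ j)%R
    (fun j => j.+1%:R `^ alpha)%R (fun j => q ^+ j)%R s s0).
- by move=> j; rewrite powR_gt0.
- by move=> j; rewrite exprn_gt0.
apply: (@pmule_lty ((kappa `^ alpha) `^ s * (tau * (1 - q)))).
- by rewrite !mulr_gt0 ?powR_gt0// subr_gt0.
- apply: le_lt_trans key; rewrite -nneseriesZl; last first.
    by move=> *; rewrite mule_ge0 ?poweR_ge0// lee_fin exprn_ge0// ltW.
  apply: lee_nneseries => [j _ _|j _].
    rewrite !mule_ge0 ?poweR_ge0 ?lee_fin ?exprn_ge0 ?(ltW q0)//.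
    by rewrite mulr_ge0 ?powR_ge0// mulr_ge0 ?(ltW tau0)// subr_ge0 ltW.
  have -> : w j = ((kappa `^ alpha) `^ s)%:E *
      (rho (tau * q ^+ j)%R * (j.+1%:R `^ alpha)%R%:E) `^ s.
    have h1 : 0 <= (kappa `^ alpha)%R%:E by rewrite lee_fin powR_ge0.
    have h2 : 0 <= rho (tau * q ^+ j)%R * (j.+1%:R `^ alpha)%R%:E.
      by rewrite mule_ge0 ?rearrangement_ge0// lee_fin powR_ge0.
    by rewrite /w powRM ?(ltW kappa0)// EFinM muleCA (poweRM _ h1 h2).
  rewrite -/rho; set X := (_ * _) `^ s.
  have -> : (tau * q ^+ j - tau * q ^+ j.+1)%R = (tau * (1 - q) * q ^+ j)%R.
    by rewrite exprS; ring.
  by rewrite [leRHS]muleAC [leLHS]muleA -!EFinM -!mulrA.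
- by apply: nneseries_ge0 => *; rewrite mule_ge0 ?poweR_ge0// lee_fin exprn_ge0// ltW.
Qed.

(** The exponent 1/s - 1 is negative, so both factors of the integrand are minimal at the right end
    tau q^j. There the power times the length of the interval is a constant times q^(j/s). *)
Lemma lorentz_dyadic (s : R) f (tau q : R) : (1 < s)%R ->
  (0 < q < 1)%R -> (0 < tau)%R -> lorentz1_norm mu s f < +oo ->
  exists2 b : nat -> R, forall j, (0 <= b j)%R /\
      rearrangement mu f (tau * q ^+ j) = (b j)%:E &
    \sum_(j <oo) (b j * q `^ (j%:R / s))%:E < +oo.
Proof.
move=> s1 q01 tau0; have /andP[q0 q1] := q01.
have s0 : (0 < s)%R by exact: lt_trans s1.
pose rho := rearrangement mu f.
pose phi (t : R) := rho t * (t `^ (s^-1 - 1))%R%:E.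
have phi0 t : 0 <= phi t by rewrite mule_ge0 ?rearrangement_ge0// lee_fin powR_ge0.
rewrite /lorentz1_norm => /pmule_lty ioo.
have {}ioo : \int[lebesgue_measure]_(t in `]0%R, +oo[) phi t < +oo.
  by apply: ioo; [rewrite invr_gt0|apply: integral_ge0 => t _; exact: phi0].
have [tmono tpos] := dyadic_open_itv tau0 q01.
pose w j := rho (tau * q ^+ j)%R * ((tau * q ^+ j) `^ (s^-1 - 1))%R%:E.
have mphi : measurable_fun (`]0%R, +oo[%classic : set R) phi.
  apply: measurable_funTS; apply: emeasurable_funM; first exact: measurable_rearrangement.
  by apply/measurable_EFinP; exact: measurable_powR.
have key := @series_le_integral `]0%R, +oo[%classic phi w (fun j => tau * q ^+ j)%R.
have {}key : \sum_(j <oo) w j * (tau * q ^+ j - tau * q ^+ j.+1)%:E < +oo.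
  apply: (le_lt_trans (key _ _ _ _ _ _ _)) => //.
  - move=> j x; rewrite /= !in_itv/= andbT => /andP[xj1 xj].
    by have := tpos j.+1; lra.
  - by move=> j; rewrite mule_ge0 ?rearrangement_ge0// lee_fin powR_ge0.
  - move=> j x; rewrite in_itv/= => /andP[xj1 xj].
    have x0 : (0 < x)%R by have := tpos j.+1; lra.
    apply: lee_pmul; rewrite ?rearrangement_ge0 ?lee_fin ?powR_ge0//.
      by apply: rearrangement_nonincreasing; exact: ltW.
    have xt0 := lt_trans x0 xj.
    rewrite -[(s^-1 - 1)%R]opprB !powRN lef_pV2 ?posrE ?powR_gt0//.
    rewrite ge0_ler_powR ?nnegrE ?subr_ge0 ?(ltW x0) ?(ltW xj) ?(ltW xt0)//.
    by rewrite invf_le1// ltW.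
have [|||b bP bs] := @rearrangement_dyadic_fin f (fun j => tau * q ^+ j)%R
    (fun j => q `^ (j%:R / s))%R (fun=> 1%R) 1%R ltr01.
- by move=> j; rewrite powR_gt0.
- by [].
- apply: (@pmule_lty (tau `^ s^-1 * (1 - q))).
  + by rewrite mulr_gt0 ?powR_gt0// subr_gt0.
  + apply: le_lt_trans key; rewrite -nneseriesZl; last first.
      by move=> *; rewrite mule_ge0 ?poweR_ge0// lee_fin.
    apply: lee_nneseries => [j _ _|j _].
      rewrite !mule_ge0 ?poweR_ge0 ?lee_fin//.
      by rewrite mulr_ge0 ?powR_ge0// subr_ge0 ltW.
    have t0 : (0 < tau * q ^+ j)%R by case/andP: (tpos j).
    rewrite mul1e poweRe1 ?mule_ge0 ?rearrangement_ge0 ?lee_fin ?powR_ge0//.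
    rewrite /w -/rho -muleA -EFinM muleCA -EFinM.
    rewrite lee_wpmul2l ?rearrangement_ge0// lee_fin.
    have -> : (tau * q ^+ j - tau * q ^+ j.+1 = (tau * q ^+ j) * (1 - q))%R.
      by rewrite exprS; ring.
    have E : ((tau * q ^+ j) `^ (s^-1 - 1) * (tau * q ^+ j) =
        tau `^ s^-1 * q `^ (j%:R / s))%R.
      rewrite -{2}[(tau * q ^+ j)%R]powRr1 ?(ltW t0)// -powRD ?(gt_eqF t0) ?implybT//.
      by rewrite subrK powRM ?exprn_ge0 ?(ltW q0) ?(ltW tau0)// -powR_mulrn ?(ltW q0)// -powRrM.
    by rewrite mulrA E mulrAC.
  + by apply: nneseries_ge0 => *; rewrite mule_ge0 ?poweR_ge0// lee_fin.
exists b => //; apply: le_lt_trans bs; apply: lee_nneseries => [j _ _|j _].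
  by rewrite lee_fin mulr_ge0 ?powR_ge0//; case: (bP j).
by rewrite mul1r powRr1// mulr_ge0 ?powR_ge0//; case: (bP j).
Qed.

End dyadic_integrals.

(** * Means over small balls *)

Section dyadic_means.
Local Open Scope ereal_scope.
Context {R : realType} {d : measure_display} {T : metricMeasurableType d R}.
Variable mu : {measure set T -> \bar R}.
Variable N : (T -> \bar R) -> \bar R.
Hypothesis mu_borel : borel_regular mu.
Hypothesis mu_balls : finite_positive_balls mu.
Hypothesis N_qb : quasi_banach_function_lattice mu N.
Variables (p s : R).
Hypothesis p1 : (1 <= p)%R.
Hypothesis s0 : (0 < s)%R.
Hypothesis mu_dim : dimension_condition mu s.
Implicit Types (x y : T) (r rho lam : R) (f : T -> \bar R).

Let p0 : (0 < p)%R. Proof. exact: lt_le_trans p1. Qed.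

Lemma measurable_ball x r : measurable (ball x r).
Proof.
apply: (open_measurableT mu_borel); rewrite openE => y.
rewrite /interior ballEmdist/= => xy; apply/nbhs_ballP.
exists (r - mdist x y)%R => /=; first by rewrite subr_gt0.
move=> z; rewrite !ballEmdist/= ltrBrDl => yz.
exact: le_lt_trans (metric_triangle _ y _) yz.
Qed.

Lemma ball_fin x r : (0 < r)%R -> mu (ball x r) \is a fin_num.
Proof.
by move=> r0; have /andP[h1 h2] := mu_balls x r0; rewrite ge0_fin_numE.
Qed.

Lemma fine_ball_gt0 x r : (0 < r)%R -> (0 < fine (mu (ball x r)))%R.
Proof. by move=> r0; apply: fine_gt0; exact: mu_balls. Qed.

(** The factor by which the dimension condition lets the measure of a ball drop when its radius is
    halved; it is the ratio [q] of all the dyadic series. *)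
Definition half_powR : R := (2^-1 `^ s)%R.

Lemma half_powR01 : (0 < half_powR < 1)%R.
Proof.
rewrite powR_gt0//=; have := @gt0_ltr_powR _ s s0 (2^-1)%R 1%R.
by rewrite powR1 !nnegrE => -> //; rewrite ?invf_lt1 ?ltr1n.
Qed.

Lemma half_powRX k : (half_powR ^+ k = (2^-1 ^+ k) `^ s)%R.
Proof.
by rewrite -powR_mulrn ?powR_ge0// -powRrM mulrC powRrM powR_mulrn.
Qed.

(** The ball of radius [2 * lam * rho] is large enough to contain every enlarged ball that occurs,
    so the embedding is used on it alone and the bounds are uniform in the centre. *)
Lemma dyadic_ball_measure x0 rho lam : (0 < rho)%R -> (1 <= lam)%R ->
  exists2 tau : R, (0 < tau <= fine (mu (ball x0 (2 * lam * rho))))%R &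
    forall x k, ball x0 rho x ->
      (tau * half_powR ^+ k <= fine (mu (ball x (lam * (rho * 2^-1 ^+ k)))))%R /\
      ball x (lam * (rho * 2^-1 ^+ k)) `<=` ball x0 (2 * lam * rho).
Proof.
move=> rho0 lam1; have [c c0 cP] := mu_dim.
have lam0 : (0 < lam)%R by exact: lt_le_trans lam1.
have R0 : (0 < 2 * lam * rho)%R by rewrite !mulr_gt0.
have /andP[q0 q1] := half_powR01.
(* Obtained by comparing a ball with itself. It gives [tau <= M], so that the samples [tau * q ^+ j]
   lie in the range of the Zygmund integral. *)
have c1 : (c <= 1)%R.
  have := cP x0 x0 1%R 1%R; rewrite ltr01 lexx => /(_ isT (ballxx _ ltr01)).
  by rewrite divr1 powR1 mulr1 divff// gt_eqF// fine_ball_gt0.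
set M := fine (mu (ball x0 (2 * lam * rho))).
have M0 : (0 < M)%R by exact: fine_ball_gt0.
(* The two radii have ratio 2^-(k+1); the extra halving accounts for the factor [half_powR]. *)
exists (c * half_powR * M)%R.
  rewrite !mulr_gt0//= ler_piMl ?(ltW M0)// mulr_ile1 ?(ltW c0) ?(ltW q0)//.
  exact: ltW.
have k1 k : (0 < (2^-1 : R) ^+ k <= 1)%R.
  by rewrite exprn_gt0//= exprn_ile1// invf_le1// ler1n.
move=> x k; have /andP[k0 k1'] := k1 k => x0x.
have r0 : (0 < lam * (rho * 2^-1 ^+ k) <= lam * rho)%R.
  by rewrite !mulr_gt0//= ler_wpM2l ?(ltW lam0)// ler_piMr// ltW.
have lr : (rho <= lam * rho)%R by rewrite ler_peMl// ltW.
split.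
- have := cP x0 x (lam * (rho * 2^-1 ^+ k))%R (2 * lam * rho)%R _ _.
  have -> : (lam * (rho * 2^-1 ^+ k) / (2 * lam * rho) = 2^-1 * 2^-1 ^+ k)%R.
    by field; rewrite !gt_eqF.
  rewrite -/M powRM// -half_powRX -/half_powR ler_pdivlMr// => h.
  apply: le_trans (h _ _).
  + by rewrite -!mulrA ler_wpM2l ?(ltW c0)// ler_wpM2l ?(ltW q0)// mulrC.
  + by case/andP: r0 => -> /le_trans; apply; rewrite -mulrA ler_peMl ?ler1n// ltW ?mulr_gt0.
  + by move: x0x; apply: le_ball; rewrite (le_trans lr)// -mulrA ler_peMl ?ler1n// ltW// mulr_gt0.
- move=> y; move: x0x; rewrite !ballEmdist/= => x0x xy.
  apply: le_lt_trans (metric_triangle _ x _) _.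
  by case/andP: r0 => _ r1; lra.
Qed.

Lemma average_le x r f (M : \bar R) : (0 < r)%R ->
  \int[mu]_(y in ball x r) f y <= mu (ball x r) * M -> average mu (ball x r) f <= M.
Proof.
move=> r0 fM; rewrite /average.
apply: (@le_trans _ _ ((fine (mu (ball x r)))^-1%:E * (mu (ball x r) * M))).
  by rewrite lee_wpmul2l// lee_fin invr_ge0 fine_ge0.
rewrite muleA -{2}(fineK (ball_fin x r0)) -EFinM mulVf ?mul1e//.
by rewrite gt_eqF// fine_ball_gt0.
Qed.

(** For [f = g] and up to a constant, [e k] majorizes the right-hand side of the Poincare inequality
    at scale k, simultaneously for all centres in the ball. *)
Definition dyadic_means_le lam f x0 rho (e : nat -> R) :=
  forall x k, ball x0 rho x ->
    (rho * 2^-1 ^+ k)%:E * average mu (ball x (lam * (rho * 2^-1 ^+ k)))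
      (fun y => f y `^ p) `^ p^-1 <= (e k)%:E.

Lemma summable_dyadic_means lam f x0 rho (e : nat -> \bar R) :
  (forall k, 0 <= e k) -> \sum_(k <oo) e k < +oo ->
  (forall x k, ball x0 rho x ->
    (rho * 2^-1 ^+ k)%:E * average mu (ball x (lam * (rho * 2^-1 ^+ k)))
      (fun y => f y `^ p) `^ p^-1 <= e k) ->
  exists e' : nat -> R, [/\ forall k, (0 <= e' k)%R,
    \sum_(k <oo) (e' k)%:E < +oo & dyadic_means_le lam f x0 rho e'].
Proof.
move=> e0 eoo eP.
have ef k : (fine (e k))%:E = e k.
  rewrite fineK// ge0_fin_numE//; apply: le_lt_trans eoo.
  exact: nneseries_ge_term.
exists (fine \o e); split.
- by move=> k; rewrite fine_ge0.
- by under eq_eseriesr do rewrite /= ef.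
- by move=> x k x0x; rewrite /= ef; exact: eP.
Qed.

(** The level-set estimate is applied with the levels shifted by k. As the ball has measure at least
    tau q^k, dividing by it turns the estimate into the tail mean, and 2^-k = q^(k/s) supplies the
    prefactor. *)
Lemma dyadic_means_of_tail lam f x0 rho tau (b : nat -> R) :
  measurable_fun setT f -> (forall x, 0 <= f x) ->
  (0 < rho)%R -> (1 <= lam)%R -> (0 < tau)%R ->
  (forall x k, ball x0 rho x ->
      (tau * half_powR ^+ k <= fine (mu (ball x (lam * (rho * 2^-1 ^+ k)))))%R /\
      ball x (lam * (rho * 2^-1 ^+ k)) `<=` ball x0 (2 * lam * rho)) ->
  (forall j, (0 <= b j)%R) ->
  (forall j, mu (ball x0 (2 * lam * rho) `&` [set x | (b j)%:E < f x]) <=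
     (tau * half_powR ^+ j)%:E) ->
  \sum_(k <oo) (half_powR `^ (k%:R / s))%R%:E *
     tail_mean half_powR p b k `^ p^-1 < +oo ->
  exists e : nat -> R, [/\ forall k, (0 <= e k)%R,
    \sum_(k <oo) (e k)%:E < +oo & dyadic_means_le lam f x0 rho e].
Proof.
move=> mf f0 rho0 lam1 tau0 ballP b0 bP soo.
have /andP[q0 q1] := half_powR01.
have lam0 : (0 < lam)%R by exact: lt_le_trans lam1.
set q := half_powR in q0 q1 soo ballP bP *.
have h0 (j k : nat) : (0 <= q ^+ j * b k `^ p)%R.
  by rewrite mulr_ge0 ?powR_ge0// exprn_ge0// ltW.
have tm0 k : 0 <= tail_mean q p b k by apply: nneseries_ge0 => *; rewrite lee_fin.
(* The level-set estimate pairs [t j] with [b j.+1]; realigning the indices costs [q^-1], whose p-th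
   root appears here. *)
pose C : R := (rho * (q^-1 `^ p^-1))%R.
have C0 : (0 <= C)%R by rewrite mulr_ge0 ?powR_ge0// ltW.
apply: (@summable_dyadic_means _ _ _ _ (fun k => C%:E *
    ((q `^ (k%:R / s))%R%:E * tail_mean q p b k `^ p^-1))).
- by move=> k; rewrite !mule_ge0 ?poweR_ge0// lee_fin powR_ge0.
- rewrite nneseriesZl; last by move=> *; rewrite mule_ge0 ?poweR_ge0// lee_fin powR_ge0.
  by rewrite lte_mul_pinfty// lee_fin.
move=> x k x0x; have [tauk ballE] := ballP x k x0x.
have rk0 : (0 < lam * (rho * 2^-1 ^+ k))%R by rewrite !mulr_gt0// exprn_gt0.
set A := ball x (lam * (rho * 2^-1 ^+ k)) in tauk ballE *.
have -> : C%:E * ((q `^ (k%:R / s))%R%:E * tail_mean q p b k `^ p^-1) =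
    (rho * 2^-1 ^+ k)%:E * (q^-1%:E * tail_mean q p b k) `^ p^-1.
  rewrite poweRM// ?lee_fin ?invr_ge0 ?(ltW q0)// poweR_EFin muleA -EFinM.
  rewrite [in RHS]muleA -EFinM; congr (_%:E * _).
  rewrite /C -!mulrA; congr (_ * _)%R; rewrite mulrC; congr (_ * _)%R.
  by rewrite /q /half_powR -powRrM mulrCA mulfV ?gt_eqF// mulr1 powR_mulrn.
rewrite lee_wpmul2l ?lee_fin ?mulr_ge0 ?exprn_ge0 ?(ltW rho0)//.
apply: gt0_ler_poweR; rewrite ?invr_ge0 ?(ltW p0)// ?in_itv/= ?leey ?andbT.
- by rewrite /average mule_ge0 ?lee_fin ?invr_ge0 ?fine_ge0// integral_ge0// => *; exact: poweR_ge0.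
- by rewrite mule_ge0// lee_fin invr_ge0 ltW.
apply: average_le => //.
have mA : measurable A by exact: measurable_ball.
apply: (le_trans (@integral_powR_level_sets _ _ _ mu A f p (fun j => b (k + j)%N)
   (fun j => tau * q ^+ (k + j))%R mA mf f0 (ltW p0) _ _ _ _)).
- by move=> j; exact: b0.
- by move=> j; rewrite mulr_ge0 ?(ltW tau0)// exprn_ge0// ltW.
- have : (tau * q ^+ k * q ^+ j)%R @[j --> \oo] --> (0 : R)%R.
    by apply: cvg_geometric; rewrite ger0_norm ?(ltW q0).
  by under eq_fun do rewrite -mulrA -exprD.
- move=> j; apply: (le_trans _ (bP (k + j)%N)); apply: le_measure; rewrite ?inE.
  + apply: measurableI => //; rewrite -[X in measurable X]setTI.
    exact: emeasurable_fun_o_infty.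
  + apply: measurableI; first exact: measurable_ball.
    by rewrite -[X in measurable X]setTI; exact: emeasurable_fun_o_infty.
  + by apply: setSI.
have muA : mu A = (fine (mu A))%:E by rewrite fineK// ball_fin.
rewrite addn0 [leRHS]muleA muA -EFinM.
have q1' : (1 <= q^-1)%R by rewrite invf_ge1// ltW.
have -> : tail_mean q p b k = (b k `^ p)%:E +
    \sum_(j <oo) (q ^+ j.+1 * b (k + j.+1)%N `^ p)%:E.
  rewrite /tail_mean (nneseries_split 0 1); last by move=> *; rewrite lee_fin; exact: h0.
  rewrite add0n big_nat1 expr0 mul1r addn0 -(nneseries_addn 1); last first.
    by move=> *; rewrite lee_fin; exact: h0.
  by congr (_ + _); apply: eq_eseriesr => j _; rewrite addn1.
have S0 : 0 <= \sum_(j <oo) (q ^+ j.+1 * b (k + j.+1)%N `^ p)%:E.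
  by apply: nneseries_ge0 => *; rewrite lee_fin; exact: h0.
rewrite ge0_muleDr ?lee_fin ?powR_ge0//; apply: leeD.
  by rewrite -!EFinM lee_fin ler_wpM2r ?powR_ge0// ler_peMr// fine_ge0.
rewrite -nneseriesZl; last by move=> *; rewrite lee_fin; exact: h0.
apply: lee_nneseries => [j _ _|j _].
  rewrite lee_fin mulr_ge0 ?powR_ge0// mulr_ge0 ?(ltW tau0)// exprn_ge0//.
  exact: ltW.
rewrite -EFinM lee_fin addnS mulrA ler_wpM2r ?powR_ge0// exprS.
rewrite -mulrA [(q^-1 * _)%R]mulrA mulVf ?gt_eqF// mul1r exprD mulrA ler_wpM2r//.
by rewrite exprn_ge0// ltW.
Qed.

Lemma lattice_restrict_lty f (E : set T) : measurable E ->
  measurable_fun setT f -> N f < +oo ->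
  measurable_fun setT (f \_ E) /\ N (f \_ E) < +oo.
Proof.
move=> mE mf Nf; have [c _ qb] := N_qb.
have mfE : measurable_fun setT (f \_ E).
  by apply/(measurable_restrictT f) => //; exact: measurable_funTS.
split => //; apply: le_lt_trans Nf; apply: (qb_lattice qb) => //.
by apply: aeW => x; rewrite /patch; case: ifP => // _; rewrite abse0.
Qed.

Lemma embeds_loc_lty (nY : set T -> (T -> \bar R) -> \bar R) f x r : (0 < r)%R ->
  embeds_loc N nY -> measurable_fun setT f -> N f < +oo ->
  nY (ball x r) (f \_ (ball x r)) < +oo.
Proof.
move=> r0 emb mf Nf; have [c c0 cP] := emb x r r0.
have [mfE NfE] := lattice_restrict_lty (measurable_ball x r) mf Nf.
by apply: (le_lt_trans (cP _ mf)); rewrite lte_mul_pinfty ?lee_fin ?(ltW c0).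
Qed.

(** No rearrangement is required: the integral of f^p over the small ball is at most the one over
    the large ball, and dividing by tau q^k gives the root 2^(ks/p), to be multiplied by 2^-k. *)
Lemma dyadic_means_powR lam f x0 rho :
  measurable_fun setT f -> (forall x, 0 <= f x) -> N f < +oo ->
  embeds_loc N (fun _ u => 'N[mu]_(p%:E)[u]) ->
  (0 < rho)%R -> (1 <= lam)%R ->
  exists2 C : R, (0 < C)%R &
    dyadic_means_le lam f x0 rho (fun k => C * (2^-1 ^+ k) `^ (1 - s / p))%R.
Proof.
move=> mf f0 Nf emb rho0 lam1.
have lam0 : (0 < lam)%R by exact: lt_le_trans lam1.
have R0 : (0 < 2 * lam * rho)%R by rewrite !mulr_gt0.
have [tau /andP[tau0 _] ballP] := dyadic_ball_measure x0 rho0 lam1.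
set E := ball x0 (2 * lam * rho) in ballP.
have mE : measurable E by exact: measurable_ball.
have /(@poweR_lty _ _ p) := embeds_loc_lty x0 R0 emb mf Nf.
rewrite poweR_Lnorm ?gt_eqF// -/E; set I := integral _ _ _ => Ioo.
have I0 : 0 <= I by apply: integral_ge0 => *; exact: poweR_ge0.
have If : I = (fine I)%:E by rewrite fineK// ge0_fin_numE.
have [mfE _] := lattice_restrict_lty mE mf Nf.
(* The [+ 1] only ensures [C > 0] when the integral vanishes. *)
pose C := (rho * (fine I / tau) `^ p^-1 + 1)%R.
have C0 : (0 < C)%R by rewrite ltr_wpDl// mulr_ge0 ?powR_ge0// ltW.
exists C => // x k x0x; have [tauk AE] := ballP x k x0x.
have rk0 : (0 < lam * (rho * 2^-1 ^+ k))%R by rewrite !mulr_gt0// exprn_gt0.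
set A := ball x _ in tauk AE *.
have /andP[q0 q1] := half_powR01.
have tk0 : (0 < tau * half_powR ^+ k)%R by rewrite mulr_gt0// exprn_gt0.
have avg : average mu A (fun y => f y `^ p) <= ((tau * half_powR ^+ k)^-1 * fine I)%:E.
  rewrite EFinM -If /average; apply: lee_pmul.
  - by rewrite lee_fin invr_ge0 fine_ge0.
  - by apply: integral_ge0 => *; exact: poweR_ge0.
  - by rewrite lee_fin lef_pV2// posrE// fine_ball_gt0.
  apply: (@le_trans _ _ (\int[mu]_(y in A) `|(f \_ E) y| `^ p)).
    rewrite le_eqVlt; apply/orP; left; apply/eqP; apply: eq_integral => y.
    by rewrite inE => /AE Ey; rewrite patchT ?inE// gee0_abs.
  apply: ge0_subset_integral => //; first exact: measurable_ball.
  - apply: (measurableT_comp (measurable_poweR _)).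
    exact: measurableT_comp.
  - by move=> *; exact: poweR_ge0.
apply: (@le_trans _ _ ((rho * 2^-1 ^+ k)%:E * ((tau * half_powR ^+ k)^-1 * fine I)%:E `^ p^-1)).
  rewrite lee_wpmul2l ?lee_fin ?mulr_ge0 ?(ltW rho0)//.
  apply: gt0_ler_poweR; rewrite ?invr_ge0 ?(ltW p0)// ?in_itv/= ?leey ?andbT//.
    rewrite /average mule_ge0 ?lee_fin ?invr_ge0 ?fine_ge0//.
    by apply: integral_ge0 => *; exact: poweR_ge0.
  by rewrite lee_fin mulr_ge0 ?fine_ge0// invr_ge0 ltW.
rewrite poweR_EFin -EFinM lee_fin.
have k0 : (0 < (2^-1 : R) ^+ k)%R by rewrite exprn_gt0.
have -> : ((tau * half_powR ^+ k)^-1 * fine I = (fine I / tau) * (half_powR ^+ k)^-1)%R.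
  by rewrite invfM mulrAC [(tau^-1 * _)%R]mulrC.
rewrite powRM ?invr_ge0 ?divr_ge0 ?fine_ge0 ?(ltW tau0)// ?exprn_ge0 ?(ltW q0)//.
rewrite half_powRX -powRN -powRrM.
have -> : (1 - s / p = 1 + (- s) * p^-1)%R by rewrite mulNr.
rewrite [in leRHS]powRD ?(gt_eqF k0) ?implybT// powRr1 ?(ltW k0)//.
set X := (_ `^ (- s * p^-1))%R; set Y := (_ `^ p^-1)%R.
have X0 : (0 <= X)%R by exact: powR_ge0.
rewrite /C -/Y mulrACA; rewrite ler_wpM2r ?mulr_ge0 ?(ltW k0)//.
by rewrite lerDl.
Qed.

(** The bound at k = 0 makes the p-mean finite, and a <= 1 + a^p on a ball of finite measure.
    Applied to u, it makes the Poincare inequality available. *)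
Lemma integrable_of_dyadic_means lam f x0 rho (e : nat -> R) :
  measurable_fun setT f -> (0 < rho)%R -> (1 <= lam)%R ->
  dyadic_means_le lam (fun x => `|f x|) x0 rho e ->
  mu.-integrable (ball x0 rho) f.
Proof.
move=> mf rho0 lam1 /(_ x0 0%N (ballxx _ rho0)); rewrite expr0 mulr1 => fe.
have lr0 : (0 < lam * rho)%R by rewrite mulr_gt0// (lt_le_trans ltr01).
have mfp : measurable_fun setT (fun y => `|f y| `^ p).
  apply: (measurableT_comp (measurable_poweR _)); exact: measurableT_comp.
have int0 A : 0 <= \int[mu]_(y in A) `|f y| `^ p.
  by apply: integral_ge0 => *; exact: poweR_ge0.
have Ioo : \int[mu]_(y in ball x0 (lam * rho)) `|f y| `^ p < +oo.
  have av0 : 0 <= average mu (ball x0 (lam * rho)) (fun y => `|f y| `^ p).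
    by rewrite mule_ge0// lee_fin invr_ge0 fine_ge0.
  have : average mu (ball x0 (lam * rho)) (fun y => `|f y| `^ p) `^ p^-1 < +oo.
    apply: (@pmule_lty _ rho) => //; last exact: poweR_ge0.
    by apply: le_lt_trans fe _; rewrite ltry.
  move/lty_poweRy; rewrite invr_eq0 gt_eqF// => /(_ isT).
  by move/pmule_lty; apply => //; rewrite invr_gt0 fine_ball_gt0.
apply/integrableP; split; first exact: measurable_funTS.
apply: (@le_lt_trans _ _ (\int[mu]_(y in ball x0 rho) (cst 1 y + `|f y| `^ p))).
  apply: ge0_le_integral => //.
  - exact: measurable_ball.
  - by apply: measurable_funTS; exact: measurableT_comp.
  - by apply: measurable_funTS; apply: emeasurable_funD.
  move=> y _; have : 0 <= `|f y| by [].
  rewrite /cst; case: (`|f y|) => [a| |] // a0; last by rewrite poweRyr ?gt_eqF// addey.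
  suff : (a <= 1 + a `^ p)%R by rewrite -lee_fin.
  have [a1|a1] := leP a 1%R; first by rewrite (le_trans a1)// lerDl powR_ge0.
  by rewrite (le_trans (le1r_powR (ltW a1) p1))// lerDr.
rewrite ge0_integralD//; last 3 first.
- exact: measurable_ball.
- by move=> *; exact: poweR_ge0.
- exact: measurable_funTS.
rewrite integral_cst; last exact: measurable_ball.
rewrite mul1e lte_add_pinfty//; first by case/andP: (mu_balls x0 rho0).
apply: le_lt_trans Ioo; apply: ge0_subset_integral.
- exact: measurable_ball.
- exact: measurable_ball.
- exact: measurable_funTS.
- by move=> *; exact: poweR_ge0.
- by apply: le_ball; rewrite ler_peMl// ltW.
Qed.

Lemma rearrangement_level_sets f (E : set T) (t : R) (b : R) :
  measurable E -> measurable_fun setT f -> (forall x, 0 <= f x) -> (0 <= t)%R ->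
  rearrangement mu (f \_ E) t = b%:E -> mu (E `&` [set x | b%:E < f x]) <= t%:E.
Proof.
move=> mE mf f0 t0 fb.
have mfE : measurable_fun setT (f \_ E).
  by apply/(measurable_restrictT f) => //; exact: measurable_funTS.
apply: (le_trans _ (mu_gt_rearrangement mfE t0 fb)); apply: le_measure; rewrite ?inE.
- apply: measurableI => //; rewrite -[X in measurable X]setTI.
  exact: emeasurable_fun_o_infty.
- rewrite -[X in measurable X]setTI; apply: emeasurable_fun_o_infty => //.
  exact: measurableT_comp.
- by move=> x [Ex bx] /=; rewrite patchT ?inE// gee0_abs.
Qed.

(** The four sets of assumptions merge here into one conclusion, the only one that continuity of v
    requires. *)
Lemma dyadic_means_summable lam f x0 rho :
  measurable_fun setT f -> (forall x, 0 <= f x) -> N f < +oo ->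
  [\/ (s < p)%R /\ embeds_loc N (fun _ u => 'N[mu]_(p%:E)[u]),
      [/\ 1%R = p, p = s & exists2 alpha : R, (1 <= alpha)%R &
        embeds_loc N (zygmund_norm mu s alpha)],
      [/\ (1 < p)%R, p = s & exists2 alpha : R, (1 < alpha)%R &
        embeds_loc N (zygmund_norm mu s alpha)]
    | (1 <= p < s)%R /\ embeds_loc N (fun _ u => lorentz1_norm mu s u)] ->
  (0 < rho)%R -> (1 <= lam)%R ->
  exists e : nat -> R, [/\ forall k, (0 <= e k)%R,
    \sum_(k <oo) (e k)%:E < +oo & dyadic_means_le lam f x0 rho e].
Proof.
move=> mf f0 Nf emb rho0 lam1.
have lam0 : (0 < lam)%R by exact: lt_le_trans lam1.
have R0 : (0 < 2 * lam * rho)%R by rewrite !mulr_gt0.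
have [tau /andP[tau0 tauM] ballP] := dyadic_ball_measure x0 rho0 lam1.
have q01 := half_powR01; have /andP[q0 q1] := q01.
set E := ball x0 (2 * lam * rho) in ballP tauM.
have mE : measurable E by exact: measurable_ball.
have ballN nY (h : embeds_loc N nY) := embeds_loc_lty x0 R0 h mf Nf.
have zyg (alpha : R) : (0 <= alpha)%R -> embeds_loc N (zygmund_norm mu s alpha) ->
  exists2 b : nat -> R, forall j, (0 <= b j)%R /\
      rearrangement mu (f \_ E) (tau * half_powR ^+ j) = (b j)%:E &
    \sum_(j <oo) (half_powR ^+ j * (b j * j.+1%:R `^ alpha) `^ s)%:E < +oo.
  move=> a0 /ballN; rewrite -/E => Zoo.
  have := zygmund_dyadic s0 a0 q01 tau0 tauM Zoo.
  (* [zygmund_norm] restricts to [E] a function that the embedding has already restricted. *)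
  have -> // : (f \_ E) \_ E = f \_ E.
  by apply/funext => x; rewrite /patch; case: ifP => // ->.
have concl (b : nat -> R) : (forall j, (0 <= b j)%R /\
      rearrangement mu (f \_ E) (tau * half_powR ^+ j) = (b j)%:E) ->
    \sum_(k <oo) (half_powR `^ (k%:R / s))%R%:E *
      tail_mean half_powR p b k `^ p^-1 < +oo ->
    exists e : nat -> R, [/\ forall k, (0 <= e k)%R,
      \sum_(k <oo) (e k)%:E < +oo & dyadic_means_le lam f x0 rho e].
  move=> bP; apply: (dyadic_means_of_tail mf f0 rho0 lam1 tau0 ballP).
    by move=> j; case: (bP j).
  move=> j; apply: rearrangement_level_sets => //.
  - by rewrite mulr_ge0 ?(ltW tau0)// exprn_ge0// ltW.
  - by case: (bP j).
case: emb => [[sp emb]|[p1' ps [alpha a1 emb]]|[p1' ps [alpha a1 emb]]|[ps emb]].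
- have [C C0 CP] := dyadic_means_powR x0 mf f0 Nf emb rho0 lam1.
  exists (fun k => C * (2^-1 ^+ k) `^ (1 - s / p))%R; split => //.
    by move=> k; rewrite mulr_ge0 ?powR_ge0// ltW.
  have sp0 : (0 < 1 - s / p)%R by rewrite subr_gt0 ltr_pdivrMr// mul1r.
  rewrite (eq_eseriesr (g := fun k => C%:E * ((2^-1 `^ (1 - s / p)) ^+ k)%R%:E)).
    rewrite nneseriesZl; last by move=> *; rewrite lee_fin exprn_ge0// powR_ge0.
    rewrite lte_mul_pinfty ?lee_fin ?(ltW C0)//.
    apply: geometric_nneseries_lty; rewrite powR_gt0//=.
    have := @gt0_ltr_powR _ _ sp0 (2^-1)%R 1%R.
    by rewrite powR1 !nnegrE => -> //; rewrite ?invf_lt1 ?ltr1n.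
  move=> k _; rewrite -EFinM; congr (_ * _)%:E.
  by rewrite -[RHS]powR_mulrn ?powR_ge0// powRAC powR_mulrn.
- have a0 : (0 <= alpha)%R by exact: le_trans a1.
  have [b bP bs] := zyg _ a0 emb; apply: (concl b) => //.
  move: bs; rewrite -ps -p1'; apply: (tail_mean_zygmund1 q01 a1).
  by move=> j; case: (bP j).
- have a0 : (0 <= alpha)%R by rewrite ltW// (lt_trans ltr01).
  have [b bP bs] := zyg _ a0 emb; apply: (concl b) => //.
  rewrite ps; apply: (tail_mean_zygmund q01 s0 a1) => // j.
  by case: (bP j).
- have s1 : (1 < s)%R by case/andP: ps => /le_lt_trans h /h.
  have [b bP bs] := lorentz_dyadic s1 q01 tau0 (ballN _ emb).
  apply: (concl b) => //; apply: tail_mean_lorentz => // j.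
  by case: (bP j).
Qed.

End dyadic_means.

(** * Chaining and covering *)

Section covering.
Local Open Scope ereal_scope.
Context {R : realType} {d : measure_display} {T : metricMeasurableType d R}.
Variable mu : {measure set T -> \bar R}.
Hypothesis mu_borel : borel_regular mu.
Hypothesis mu_balls : finite_positive_balls mu.
Variable s : R.
Hypothesis mu_dim : dimension_condition mu s.
Implicit Types (x y z : T) (r rho : R).

Lemma ge0_integral_le_cover (I : Type) (l : seq I) (F : I -> set T) (D : set T)
    (f : T -> \bar R) :
  measurable D -> (forall i, measurable (F i)) -> measurable_fun setT f ->
  (forall x, 0 <= f x) -> D `<=` \big[setU/set0]_(i <- l) F i ->
  \int[mu]_(x in D) f x <= \sum_(i <- l) \int[mu]_(x in F i) f x.
Proof.
move=> mD mF mf f0; elim: l D mD => [|i l ih] D mD.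
  by rewrite !big_nil subset0 => ->; rewrite integral_set0.
rewrite !big_cons => Dil.
have -> : D = (D `&` F i) `|` (D `\` F i) by rewrite setUIDK.
rewrite ge0_integral_setU//; last 4 first.
- exact: measurableI.
- exact: measurableD.
- exact: measurable_funTS.
- by apply/disj_set2P; rewrite setIC setDE setIACA [_ `&` F i]setIC setICr setI0.
apply: leeD.
  apply: ge0_subset_integral => //; first exact: measurableI.
  exact: measurable_funTS.
apply: ih; first exact: measurableD.
by move=> x [/Dil[]].
Qed.

Lemma sum_measure_separated (l : seq T) (r : R) (D : set T) :
  measurable D -> pairwise (fun y z => (2 * r <= mdist y z)%R) l ->
  (forall y, y \in l -> ball y r `<=` D) ->
  \sum_(y <- l) mu (ball y r) <= mu D.
Proof.
elim: l D => [|y l ih] D mD; first by rewrite big_nil.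
rewrite big_cons /= => /andP[yl sepl] lD.
have mB := measurable_ball mu_borel.
have yD : ball y r `<=` D by apply: lD; rewrite mem_head.
have -> : mu D = mu (ball y r) + mu (D `\` ball y r).
  rewrite -measureU//; last 2 first.
  - exact: measurableD.
  - by apply/seteqP; split => // x [? []].
  by rewrite setDUK.
rewrite leeD2l//; apply: ih => //; first exact: measurableD.
move=> z zl w zw; split; first by apply: lD zw; rewrite inE zl orbT.
move=> yw; have /allP/(_ _ zl) := yl; rewrite leNgt => /negP; apply.
move: zw yw; rewrite !ballEmdist/= => zw yw.
apply: le_lt_trans (metric_triangle _ w _) _.
by rewrite (metric_sym w); lra.
Qed.

(** A separated family of maximal size covers. A maximum exists because the balls of half radius are
    disjoint in [ball x0 (2 * rho)] and each has measure at least [delta], so there are at most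
    [M / delta] points. *)
Lemma separated_cover x0 rho r : (0 < r <= rho)%R ->
  exists l : seq T, [/\ forall y, y \in l -> ball x0 rho y,
    pairwise (fun y z => (r <= mdist y z)%R) l &
    forall z, ball x0 rho z -> exists2 y, y \in l & ball y r z].
Proof.
move=> /andP[r0 rrho]; have rho0 : (0 < rho)%R by exact: lt_le_trans rrho.
have R0 : (0 < 2 * rho)%R by rewrite mulr_gt0.
have [c c0 cP] := mu_dim.
set M := fine (mu (ball x0 (2 * rho))).
have M0 : (0 < M)%R by exact: fine_ball_gt0.
pose delta := (c * (r / 2 / (2 * rho)) `^ s * M)%R.
have delta0 : (0 < delta)%R by rewrite !mulr_gt0// powR_gt0// !divr_gt0.
have lower y : ball x0 rho y -> (delta%:E <= mu (ball y (r / 2))).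
  move=> x0y; have r2 : (0 < r / 2)%R by rewrite divr_gt0.
  rewrite -(fineK (ball_fin mu_balls y r2)) lee_fin -ler_pdivlMr//; apply: cP.
    by rewrite r2/=; lra.
  by move: x0y; apply: le_ball; lra.
pose P (n : nat) := `[< exists l : seq T, [/\ size l = n,
   forall y, y \in l -> ball x0 rho y &
   pairwise (fun y z => (r <= mdist y z)%R) l] >].
have P0 : exists n, P n by exists 0%N; apply/asboolP; exists [::].
have Pbound n : P n -> (n <= Num.truncn (M / delta))%N.
  move/asboolP => [l [<- lB lsep]].
  rewrite truncn_ge_nat ?divr_ge0 ?(ltW M0) ?(ltW delta0)//.
  rewrite ler_pdivlMr// -lee_fin [leRHS]fineK ?ball_fin//.
  apply: (le_trans _ (@sum_measure_separated l (r / 2)%R _ _ _ _)).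
  - rewrite mulr_natl.
    have -> : ((delta *+ size l)%:E = \sum_(y <- l) delta%:E).
      by rewrite sumEFin big_const_seq count_predT -Monoid.iteropE.
    rewrite big_seq [leRHS]big_seq; apply: lee_sum => y yl.
    exact: (lower _ (lB _ yl)).
  - exact: (measurable_ball mu_borel).
  - by move: lsep; rewrite mulrC divfK.
  - move=> y /lB; rewrite !ballEmdist/= => x0y z /= yz.
    by apply: le_lt_trans (metric_triangle _ y _) _; lra.
have [n /asboolP[l [ln lB lsep]] nmax] := ex_maxnP P0 Pbound.
exists l; split => // z x0z; apply: contrapT => noy.
have : (n.+1 <= n)%N; last by rewrite ltnn.
apply: nmax; apply/asboolP; exists (z :: l); split; first by rewrite /= ln.
- by move=> y; rewrite inE => /predU1P[->//|/lB].
rewrite /= lsep andbT; apply/allP => y yl; rewrite leNgt; apply/negP => zy.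
by apply: noy; exists y => //; rewrite ballEmdist/= metric_sym.
Qed.

End covering.

(** * Sequences with summable increments *)

Section fast_cauchy.
Context {R : realType}.

Definition series_tail (e : nat -> R) k : R := fine (\sum_(k <= j <oo) (e j)%:E)%E.

Variable e : nat -> R.
Hypothesis e0 : forall k, 0 <= e k.
Hypothesis eoo : (\sum_(j <oo) (e j)%:E < +oo)%E.

Lemma series_tail_fin k : (\sum_(k <= j <oo) (e j)%:E)%E = (series_tail e k)%:E.
Proof.
rewrite /series_tail fineK// ge0_fin_numE; last first.
  by apply: nneseries_ge0 => *; rewrite lee_fin.
apply: le_lt_trans eoo; rewrite [leRHS](nneseries_split 0 k); last first.
  by move=> *; rewrite lee_fin.
by rewrite add0n leeDr// sume_ge0// => *; rewrite lee_fin.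
Qed.

Lemma series_tail_ge_sum k m : \sum_(k <= j < m) e j <= series_tail e k.
Proof.
rewrite -lee_fin -series_tail_fin -sumEFin.
by apply: nneseries_lim_ge => *; rewrite lee_fin.
Qed.

Lemma series_tail_ge0 k : 0 <= series_tail e k.
Proof. by have := series_tail_ge_sum k k; rewrite big_geq. Qed.

Lemma series_tail_ge k : e k <= series_tail e k.
Proof. by have := series_tail_ge_sum k k.+1; rewrite big_nat1. Qed.

Lemma series_tail_nonincreasing k : series_tail e k.+1 <= series_tail e k.
Proof.
rewrite -lee_fin -!series_tail_fin [leRHS](nneseries_split k 1); last first.
  by move=> *; rewrite lee_fin.
by rewrite addn1 leeDr// sume_ge0// => *; rewrite lee_fin.
Qed.

Lemma series_tail_cvg0 : series_tail e k @[k --> \oo] --> (0 : R).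
Proof.
have h := @nneseries_tail_cvg _ (fun j => (e j)%:E) xpredT eoo
  (fun k _ => e0 k : (0 <= (e k)%:E)%E).
rewrite (_ : (fun k => _) = EFin \o series_tail e) in h; last first.
  by apply/funext => k; rewrite series_tail_fin.
by have [_] := (fine_cvgP _ _).1 h.
Qed.

Lemma fast_cauchy_cvg (a : nat -> R) (K : R) : 0 <= K ->
  (forall k, `|a k.+1 - a k| <= K * e k) ->
  cvgn a /\ forall k, `|limn a - a k| <= K * series_tail e k.
Proof.
move=> K0 aK.
have aE k m : `|a (k + m)%N - a k| <= K * series_tail e k.
  apply: (@le_trans _ _ (K * \sum_(k <= j < k + m) e j)); last first.
    by rewrite ler_wpM2l// series_tail_ge_sum.
  elim: m => [|m ih]; first by rewrite addn0 subrr normr0 big_geq// mulr0.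
  rewrite addnS big_nat_recr ?leq_addr//= mulrDr [leRHS]addrC.
  by rewrite (le_trans (ler_distD (a (k + m)%N) _ _))// lerD.
have KE0 : K * series_tail e k @[k --> \oo] --> (0 : R).
  by rewrite -(mulr0 K); apply: cvgMr => //; exact: series_tail_cvg0.
have ca : cvgn a.
  apply/cauchy_cvgP/cauchy_exP => eps eps0.
  have /cvgrPdist_lt/(_ _ eps0)[k _ /(_ k (leqnn k))] := KE0.
  rewrite sub0r normrN ger0_norm ?mulr_ge0 ?series_tail_ge0// => Keps.
  exists (a k); exists k => // m /= km; rewrite /ball/= distrC.
  by rewrite -(subnKC km); exact: le_lt_trans (aE _ _) Keps.
split => // k; apply/ler_addgt0Pr => eps eps0.
have /cvgrPdist_lt/(_ _ eps0)[m _ /(_ (k + m)%N)] := ca.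
rewrite /= leq_addl => /(_ isT) lm.
by rewrite (le_trans (ler_distD (a (k + m)%N) _ _))// [leRHS]addrC lerD// ltW.
Qed.

End fast_cauchy.

(** * Chaining of averages through the Poincare inequality *)

Section chaining.
Local Open Scope ereal_scope.
Context {R : realType} {d : measure_display} {T : metricMeasurableType d R}.
Variable mu : {measure set T -> \bar R}.
Hypothesis mu_borel : borel_regular mu.
Hypothesis mu_balls : finite_positive_balls mu.
Variables (s cD cP lam p : R).
Hypothesis mu_dim : dimension_condition mu s.
Hypothesis cD1 : (1 <= cD)%R.
Hypothesis mu_dbl : forall x r, (0 < r)%R ->
  mu (ball x (2 * r)) <= cD%:E * mu (ball x r).
Hypothesis cP0 : (0 < cP)%R.
Hypothesis mu_poincare : forall x r u g, (0 < r)%R -> locally_integrable1 mu u ->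
  upper_gradient u g ->
  average mu (ball x r) (fun y => `|u y - average mu (ball x r) u|)
    <= cP%:E * diameter (ball x r) *
       average mu (ball x (lam * r)) (fun y => g y `^ p) `^ p^-1.
Variables u g : T -> \bar R.
Hypothesis u_meas : measurable_fun setT u.
Hypothesis u_loc : locally_integrable1 mu u.
Hypothesis u_g : upper_gradient u g.
Implicit Types (x y z : T) (r : R) (e : nat -> R).

Let mB := measurable_ball mu_borel.

Definition ball_average y r : R := fine (average mu (ball y r) u).

Lemma averageE y r : (0 < r)%R -> average mu (ball y r) u = (ball_average y r)%:E.
Proof.
move=> r0; rewrite /ball_average fineK// /average fin_numM//.
exact: integrable_fin_num (u_loc y r0).
Qed.

Lemma diameter_ball y r : diameter (ball y r) <= (2 * r)%:E.
Proof.
apply: ge_ereal_sup => _ [z yz [w yw] <-]; rewrite lee_fin.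
move: yz yw; rewrite !ballEmdist/= => yz yw.
by apply: le_trans (metric_triangle _ y _) _; rewrite (metric_sym z); lra.
Qed.

Definition mean_gradient y r : \bar R :=
  average mu (ball y (lam * r)) (fun y => g y `^ p) `^ p^-1.

Lemma oscillation_le y r (k : R) : (0 < r)%R -> r%:E * mean_gradient y r <= k%:E ->
  \int[mu]_(z in ball y r) `|u z - (ball_average y r)%:E| <=
  (2 * cP * k * fine (mu (ball y r)))%:E.
Proof.
move=> r0 rk; have := mu_poincare y r0 u_loc u_g.
rewrite averageE// -/(mean_gradient y r) => poin.
have m0 := fine_ball_gt0 mu_balls y r0.
have {}poin : average mu (ball y r) (fun z => `|u z - (ball_average y r)%:E|) <=
    (2 * cP * k)%:E.
  apply: (le_trans poin).
  apply: (@le_trans _ _ (cP%:E * (2 * r)%:E * mean_gradient y r)).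
    rewrite lee_wpmul2r ?poweR_ge0// lee_wpmul2l ?lee_fin ?(ltW cP0)//.
    exact: diameter_ball.
  rewrite -EFinM mulrA EFinM -muleA [(cP * 2)%R]mulrC [leRHS]EFinM.
  by rewrite lee_wpmul2l// lee_fin mulr_ge0// ltW.
move: poin; rewrite /average => poin.
have : (fine (mu (ball y r)))%:E * ((fine (mu (ball y r)))^-1%:E *
    \int[mu]_(z in ball y r) `|u z - (ball_average y r)%:E|) <=
    (fine (mu (ball y r)))%:E * (2 * cP * k)%:E.
  by rewrite lee_wpmul2l// lee_fin ltW.
by rewrite muleA -EFinM mulfV ?gt_eqF// mul1e -EFinM mulrC.
Qed.

Lemma double_ball y z r : ball y (r / 2) z ->
  ball z (r / 2) `<=` ball y r /\ ball y r `<=` ball z (2 * r).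
Proof.
rewrite ballEmdist/= => yz; have r0 : (0 < r / 2)%R := le_lt_trans (mdist_ge0 y z) yz.
split=> w; rewrite !ballEmdist/= => zw.
  by apply: le_lt_trans (metric_triangle _ z _) _; lra.
by apply: le_lt_trans (metric_triangle _ y _) _; rewrite metric_sym; lra.
Qed.

Lemma double_ball_measure z r : (0 < r)%R ->
  mu (ball z (2 * r)) <= (cD ^+ 2)%:E * mu (ball z (r / 2)).
Proof.
move=> r0; have r2 : (0 < r / 2)%R by rewrite divr_gt0.
apply: (le_trans (mu_dbl z r0)).
rewrite expr2 EFinM -muleA lee_wpmul2l ?lee_fin ?(le_trans ler01)//.
by have := mu_dbl z r2; rewrite (_ : 2 * (r / 2) = r)%R//; field.
Qed.

(** The 2 comes from the diameter being at most [2 * r]; [cD ^+ 2] compares the ball of radius [r]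
    about [y] with that of radius [r / 2] about a nearby [z], through the one of radius [2 * r]
    about [z]. *)
Definition chain_constant : R := (2 * cP * cD ^+ 2)%R.

Lemma chain_constant_ge0 : (0 <= chain_constant)%R.
Proof. by rewrite /chain_constant !mulr_ge0 ?exprn_ge0 ?(ltW cP0)// (le_trans ler01). Qed.

(** Halves the radius and moves the centre in one step. With [z = y] it drives the telescoping
    towards the limit; with [z] different from [y] it compares the limits at two points. *)
Lemma ball_average_step y z r (k : R) : (0 <= k)%R -> (0 < r)%R -> ball y (r / 2) z ->
  r%:E * mean_gradient y r <= k%:E ->
  (`|ball_average z (r / 2) - ball_average y r| <= chain_constant * k)%R.
Proof.
move=> k0 r0 yz rk; have [zy yz2] := double_ball yz.
have r2 : (0 < r / 2)%R by rewrite divr_gt0.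
set a := ball_average y r; set B' := ball z (r / 2).
have m0 : (0 < fine (mu B'))%R := fine_ball_gt0 mu_balls z r2.
have muB' : mu B' = (fine (mu B'))%:E by rewrite fineK// ball_fin.
have iu : mu.-integrable B' u := u_loc z r2.
have ia : mu.-integrable B' (cst a%:E).
  apply/integrableP; split; first exact: measurable_cst.
  have -> : \int[mu]_(w in B') `|cst a%:E w| = `|a%:E| * mu B'.
    exact: (integral_cst mu (mB z (r / 2)) `|a%:E|).
  by rewrite muB' abse_EFin -EFinM ltry.
have iE : \int[mu]_(w in B') (u w - a%:E) =
    ((ball_average z (r / 2) - a) * fine (mu B'))%:E.
  have -> : \int[mu]_(w in B') (u w - a%:E) =
      \int[mu]_(w in B') u w - \int[mu]_(w in B') cst a%:E w.
    exact: (integralB (mB z (r / 2)) iu ia).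
  have -> : \int[mu]_(w in B') cst a%:E w = a%:E * mu B'.
    exact: (integral_cst mu (mB z (r / 2))).
  rewrite mulrBl EFinB muB' -EFinM; congr (_ - _).
  have := averageE z r2; rewrite /average -/B' => h.
  by rewrite EFinM -h muleAC -EFinM mulVf ?gt_eqF// mul1e.
have iua : mu.-integrable B' (fun w => u w - a%:E) by apply: integrableB => //; exact: mB.
have mua : measurable_fun setT (fun w => u w - a%:E).
  exact: emeasurable_funB.
have : `|\int[mu]_(w in B') (u w - a%:E)| <= \int[mu]_(w in ball y r) `|u w - a%:E|.
  apply: (le_trans (le_abse_integral _ _ _)); first exact: mB.
    by case/integrableP: iua.
  apply: ge0_subset_integral => //; try exact: mB.
  by apply: measurable_funTS; exact: measurableT_comp.
move=> /le_trans/(_ (oscillation_le r0 rk)).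
rewrite iE abse_EFin lee_fin normrM (ger0_norm (ltW m0)).
move=> /le_trans h; rewrite -(ler_pM2r m0); apply: h.
have mm : (fine (mu (ball y r)) <= cD ^+ 2 * fine (mu B'))%R.
  rewrite -lee_fin EFinM -muB' fineK ?ball_fin//.
  apply: le_trans (double_ball_measure z r0).
  by apply: le_measure; rewrite ?inE//; exact: mB.
rewrite /chain_constant [leRHS]mulrAC -[leRHS]mulrA.
have ck : (0 <= 2 * cP * k)%R by rewrite !mulr_ge0// ltW.
apply: (le_trans (ler_wpM2l ck mm)).
by rewrite le_eqVlt; apply/orP; left; apply/eqP; ring.
Qed.

(** The radii do not refer to any ambient ball, which makes this a single function on the whole
    space. *)
Definition dyadic_limit y : R := limn (fun k => ball_average y (2^-1 ^+ k)).

Section one_ball.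
Variables (x0 : T) (n : nat) (e : nat -> R).
Let rho : R := (2 ^+ n)%R.
Let rad k : R := (rho * 2^-1 ^+ k)%R.
Hypothesis e0 : forall k, (0 <= e k)%R.
Hypothesis eoo : \sum_(k <oo) (e k)%:E < +oo.
Hypothesis eP : dyadic_means_le mu p lam g x0 rho e.

Let rho0 : (0 < rho)%R. Proof. by rewrite exprn_gt0. Qed.

Let rad0 k : (0 < rad k)%R.
Proof. by rewrite mulr_gt0// exprn_gt0. Qed.

Let radS k : rad k.+1 = (rad k / 2)%R.
Proof. by rewrite /rad exprSr mulrA. Qed.

Let rad_le k : (rad k <= rho)%R.
Proof. by rewrite /rad ler_piMr ?(ltW rho0)// exprn_ile1// invf_le1// ler1n. Qed.

Let step y z k : ball x0 rho y -> ball y (rad k.+1) z ->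
  (`|ball_average z (rad k.+1) - ball_average y (rad k)| <= chain_constant * e k)%R.
Proof. by move=> x0y; rewrite radS => yz; apply: ball_average_step => //; exact: eP. Qed.

Lemma dyadic_limit_dist y k : ball x0 rho y ->
  (`|dyadic_limit y - ball_average y (rad k)| <= chain_constant * series_tail e k)%R.
Proof.
move=> x0y; pose a k := ball_average y (rad k).
have [ca caP] : cvgn a /\ forall k, (`|limn a - a k| <= chain_constant * series_tail e k)%R.
  apply: fast_cauchy_cvg => // [|j]; first exact: chain_constant_ge0.
  by apply: step => //; exact: ballxx.
suff -> : dyadic_limit y = limn a by exact: caP.
(* [rad (k + n)] is 2^-k, so the sequence defining [dyadic_limit] is [a] shifted by [n]. *)
apply/cvg_lim => //; rewrite (_ : (fun k => _) = [sequence a (k + n)%N]_k).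
  by rewrite cvg_shiftn.
apply/funext => j; rewrite /a/= /rad exprD mulrCA -exprMn.
by rewrite divff// expr1n mulr1.
Qed.

(** The path goes from the limit at [y] to its average at scale k, then to the average at [z] at
    scale k + 1, then to the limit at [z]. Each of the three moves costs at most [chain_constant]
    times the tail. *)
Lemma dyadic_limit_modulus y z k : ball x0 rho y -> ball x0 rho z ->
  ball y (rad k.+1) z ->
  (`|dyadic_limit y - dyadic_limit z| <= 3 * chain_constant * series_tail e k)%R.
Proof.
move=> x0y x0z yz; have K0 := chain_constant_ge0.
have h1 := dyadic_limit_dist k x0y; have h2 := dyadic_limit_dist k.+1 x0z.
have h3 := step x0y yz.
have h4 : (chain_constant * e k <= chain_constant * series_tail e k)%R.
  by rewrite ler_wpM2l// series_tail_ge.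
have h5 : (chain_constant * series_tail e k.+1 <= chain_constant * series_tail e k)%R.
  by rewrite ler_wpM2l// series_tail_nonincreasing.
rewrite distrC in h3; rewrite distrC in h2.
have t1 := ler_distD (ball_average y (rad k)) (dyadic_limit y) (dyadic_limit z).
have t2 := ler_distD (ball_average z (rad k.+1)) (ball_average y (rad k)) (dyadic_limit z).
by move: h4 h5; rewrite -mulrA; lra.
Qed.

(** Both functions are compared with the average [a]: [u] in the mean by the Poincare inequality
    (one unit of the constant 3), the limit pointwise (two units). Centres in the half ball keep the
    small balls inside [ball x0 rho]. *)
Lemma integral_dist_dyadic_limit_ball y k : measurable_fun setT dyadic_limit ->
  ball x0 (rho / 2) y ->
  \int[mu]_(z in ball y (rad k.+1)) `|u z - (dyadic_limit z)%:E| <=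
  (3 * chain_constant * series_tail e k)%:E * mu (ball y (rad k)).
Proof.
move=> mv x0y; have K0 := chain_constant_ge0.
have x0y' : ball x0 rho y by move: x0y; apply: le_ball; have := rho0; lra.
pose a := ball_average y (rad k).
have near_a z : ball y (rad k.+1) z ->
    (`|dyadic_limit z - a| <= 2 * chain_constant * series_tail e k)%R.
  move=> yz; have x0z : ball x0 rho z.
    have h := rad_le k; move: x0y yz; rewrite radS !ballEmdist/= => x0y yz.
    by apply: le_lt_trans (metric_triangle _ y _) _; lra.
  have h1 := dyadic_limit_dist k.+1 x0z; have h2 := step x0y' yz.
  have h4 := ler_wpM2l K0 (series_tail_ge e0 eoo k).
  have h5 := ler_wpM2l K0 (series_tail_nonincreasing e0 eoo k).
  have t1 := ler_distD (ball_average z (rad k.+1)) (dyadic_limit z) a.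
  by move: h4 h5; rewrite -mulrA /a; lra.
set B' := ball y (rad k.+1); set B := ball y (rad k).
have B'B : B' `<=` B.
  by apply: le_ball; rewrite radS; have := rad0 k; lra.
have mB' : measurable B' by exact: mB.
pose C := (2 * chain_constant * series_tail e k)%R.
have tk0 : (0 <= series_tail e k)%R by exact: series_tail_ge0.
have C0 : (0 <= C)%R by rewrite /C mulr_ge0// mulr_ge0.
have mua : measurable_fun setT (fun z => `|u z - a%:E|).
  by apply: measurableT_comp => //; exact: emeasurable_funB.
apply: (@le_trans _ _ (\int[mu]_(z in B') (`|u z - a%:E| + cst C%:E z))).
  apply: ge0_le_integral => //.
  - apply: measurable_funTS; apply: measurableT_comp => //.
    by apply: emeasurable_funB => //; exact/measurable_EFinP.
  - by apply: measurable_funTS; exact: emeasurable_funD.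
  move=> z /near_a; rewrite -/C => zC.
  case: (u z) => [w| |] //=; rewrite -?EFinB -?EFinD ?lee_fin ?addye ?leey//.
  apply: (le_trans (ler_distD a _ _)); rewrite lerD//.
  by rewrite distrC.
rewrite ge0_integralD//; last first.
  exact: measurable_funTS.
have -> : \int[mu]_(z in B') cst C%:E z = C%:E * mu B' by exact: (integral_cst mu mB').
have -> : (3 * chain_constant * series_tail e k = chain_constant * series_tail e k + C)%R.
  by rewrite /C; ring.
have muB : mu B = (fine (mu B))%:E by rewrite fineK// ball_fin.
rewrite EFinD ge0_muleDl ?lee_fin ?(mulr_ge0 K0 tk0)//; apply: leeD; last first.
  rewrite lee_wpmul2l ?lee_fin//; apply: le_measure; rewrite ?inE//; exact: mB.
apply: (@le_trans _ _ (\int[mu]_(z in B) `|u z - a%:E|)).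
  apply: ge0_subset_integral => //; first exact: mB.
  exact: measurable_funTS.
apply: (le_trans (oscillation_le (rad0 k) (eP _ x0y'))).
rewrite muB -EFinM lee_fin ler_wpM2r ?fine_ge0//.
rewrite (@le_trans _ _ (chain_constant * e k)%R)//; last first.
  by rewrite ler_wpM2l// series_tail_ge.
rewrite /chain_constant ler_wpM2r// ler_peMr ?mulr_ge0 ?(ltW cP0)//.
by rewrite exprn_ege1.
Qed.

(** Plays the role of Lebesgue differentiation. The half ball is covered by balls of radius
    [rad k.+1] with separated centres. By doubling, the measures of the balls of radius [rad k] are
    controlled by those of the disjoint balls of radius [rad k.+2], whose sum is bounded
    independently of k; the tail then tends to 0. *)
Lemma dyadic_limit_ae : measurable_fun setT dyadic_limit ->
  \int[mu]_(z in ball x0 (rho / 2)) `|u z - (dyadic_limit z)%:E| = 0.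
Proof.
move=> mv; have K0 := chain_constant_ge0.
set I := integral _ _ _.
have I0 : 0 <= I by apply: integral_ge0.
set M := fine (mu (ball x0 rho)).
have muM : mu (ball x0 rho) = M%:E by rewrite fineK// ball_fin.
have M0 : (0 < M)%R by exact: fine_ball_gt0.
have mabs : measurable_fun setT (fun z => `|u z - (dyadic_limit z)%:E|).
  apply: measurableT_comp => //.
  by apply: emeasurable_funB => //; exact/measurable_EFinP.
pose C := (3 * chain_constant * cD ^+ 2 * M)%R.
have cD0 : (0 <= cD ^+ 2)%R by rewrite exprn_ge0// (le_trans ler01).
have K3 : (0 <= 3 * chain_constant)%R := mulr_ge0 (ler0n _ 3) K0.
have Ik k : I <= (C * series_tail e k)%:E.
  have tk0 : (0 <= series_tail e k)%R by exact: series_tail_ge0.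
  have K3t := mulr_ge0 K3 tk0.
  have [|l [lB lsep lcov]] := separated_cover mu_borel mu_balls mu_dim x0
      (rho := (rho / 2)%R) (r := rad k.+1).
    by rewrite rad0 radS/= ler_pM2r// rad_le.
  have := @ge0_integral_le_cover _ _ _ mu _ l (fun y => ball y (rad k.+1)) _ _
    (mB x0 (rho / 2)%R) (fun y => mB y _) mabs.
  move=> /(_ (fun z => abse_ge0 _)) cov.
  apply: (le_trans (cov _)).
    by move=> z /lcov[y yl yz]; rewrite -bigcup_seq; exists y.
  apply: (@le_trans _ _ (\sum_(y <- l) 
    (3 * chain_constant * series_tail e k * cD ^+ 2)%:E * mu (ball y (rad k.+2)))).
    rewrite big_seq [leRHS]big_seq; apply: lee_sum => y yl.
    apply: (le_trans (integral_dist_dyadic_limit_ball k mv (lB _ yl))).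
    rewrite [X in _ <= X * _]EFinM -[leRHS]muleA lee_wpmul2l ?lee_fin//.
    have := double_ball_measure y (rad0 k.+1).
    by rewrite -radS radS [(2 * _)%R]mulrC divfK.
  rewrite -ge0_sume_distrr//.
  have -> : (C * series_tail e k)%:E = (3 * chain_constant * series_tail e k * cD ^+ 2)%:E * M%:E.
    by rewrite -EFinM; congr EFin; rewrite /C; ring.
  rewrite lee_wpmul2l ?lee_fin ?(mulr_ge0 K3t cD0)//.
  rewrite -muM; apply: (sum_measure_separated mu_borel (mB x0 rho)).
  - by move: lsep; rewrite (radS k.+1) mulrC divfK.
  - move=> y /lB; have := rad_le k; have := rho0.
    rewrite !ballEmdist (radS k.+1) radS/= => rp rk x0y z /= yz.
    by apply: le_lt_trans (metric_triangle _ y _) _; lra.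
apply/eqP; rewrite eq_le I0 andbT; apply/lee_addgt0Pr => eps eps0; rewrite add0e.
have Ct0 : (C * series_tail e k)%R @[k --> \oo] --> (0 : R)%R.
  by rewrite -(mulr0 C); apply: cvgMr => //; exact: series_tail_cvg0.
have /cvgrPdist_lt/(_ _ eps0)[k _ /(_ k (leqnn k))] := Ct0.
rewrite sub0r normrN => Ceps; apply: (le_trans (Ik k)).
by rewrite lee_fin (le_trans (ler_norm _))// ltW.
Qed.

End one_ball.

End chaining.

(** * From single balls to the whole space, and the Hölder estimate *)

Lemma ae_eq_of_integral_balls (R : realType) (d : measure_display)
    (T : metricMeasurableType d R) (mu : {measure set T -> \bar R}) (x0 : T)
    (u : T -> \bar R) (v : T -> R) :
  borel_regular mu -> measurable_fun setT u -> measurable_fun setT v ->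
  (forall n, \int[mu]_(x in ball x0 (2 ^+ n / 2)) `|u x - (v x)%:E| = 0)%E ->
  {ae mu, forall x, u x = (v x)%:E}.
Proof.
move=> mu_borel mu_ mv int0.
have muv : measurable_fun setT (fun x => u x - (v x)%:E)%E.
  by apply: emeasurable_funB => //; exact/measurable_EFinP.
have : \forall x \ae mu, forall n, ball x0 (2 ^+ n / 2) x ->
    (u x - (v x)%:E = 0)%E.
  apply: ae_foralln => n; apply: (ae_eq_integral_abs mu _ _).1 => //.
  - exact: (measurable_ball mu_borel).
  - exact: measurable_funTS.
apply: filterS => x h.
have [n x0x] : exists n, ball x0 (2 ^+ n / 2) x.
  pose m := Num.truncn (2 * mdist x0 x); exists m.+1.
  rewrite ballEmdist/= ltr_pdivlMr// mulrC.
  apply: (@lt_le_trans _ _ m.+1%:R); first by rewrite truncnS_gt.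
  by rewrite -natrX ler_nat ltnW// ltn_expl.
by move: (h n x0x); case: (u x) => [a| |] //= [/eqP]; rewrite subr_eq0 => /eqP ->.
Qed.

Lemma series_tail_geometric (R : realType) (C theta : R) k : 0 <= C ->
  0 < theta < 1 -> series_tail (fun j => C * theta ^+ j) k <= C / (1 - theta) * theta ^+ k.
Proof.
move=> C0 /andP[t0 t1]; have t1' : 0 < 1 - theta by rewrite subr_gt0.
have nn j : (0 <= (C * theta ^+ j)%:E :> \bar R)%E.
  by rewrite lee_fin mulr_ge0// exprn_ge0// ltW.
have h : (\sum_(k <= j <oo) (C * theta ^+ j)%:E <=
    (C / (1 - theta) * theta ^+ k)%:E)%E.
  rewrite -(nneseries_addn k)//; apply: nneseries_le_bound => // n.
  rewrite sumEFin lee_fin.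
  under eq_bigr do rewrite exprD [theta ^+ _ * _]mulrC mulrA.
  rewrite -mulr_sumr [leRHS]mulrAC ler_wpM2l ?mulr_ge0 ?exprn_ge0 ?(ltW t0)//.
  have := geometric_le_lim n ler01 t0; rewrite ger0_norm ?(ltW t0)// mul1r => /(_ t1).
  by apply: le_trans; rewrite /series/= ler_sum// => j _; rewrite mul1r.
rewrite /series_tail -lee_fin fineK// ge0_fin_numE; last exact: nneseries_ge0.
by apply: le_lt_trans h _; rewrite ltry.
Qed.

Theorem theorem7p1 (R : realType) (d : measure_display)
    (T : metricMeasurableType d R)
    (mu : {sigma_finite_measure set T -> \bar R})
    (N : (T -> \bar R) -> \bar R) (p s : R) :
  borel_regular mu -> finite_positive_balls mu -> doubling mu ->
  quasi_banach_function_lattice mu N ->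
  1 <= p -> poincare mu p ->
  0 < s -> dimension_condition mu s ->
  [\/ s < p /\ embeds_loc N (fun _ u => 'N[mu]_(p%:E)[u])%E,
      [/\ 1 = p, p = s & exists2 alpha : R, 1 <= alpha &
        embeds_loc N (zygmund_norm mu s alpha)],
      [/\ 1 < p, p = s & exists2 alpha : R, 1 < alpha &
        embeds_loc N (zygmund_norm mu s alpha)]
    | 1 <= p < s /\ embeds_loc N (fun _ u => lorentz1_norm mu s u)] ->
  forall u : T -> \bar R, newton_space N u ->
  exists v : T -> R,
    [/\ newton_space N (EFin \o v),
        continuous v,
        quasi_everywhere N (fun x => u x = (v x)%:E)
      & s < p /\ embeds_loc N (fun _ u => 'N[mu]_(p%:E)[u])%E ->
        locally_holder (1 - s / p) v].
Proof.
move=> mu_borel mu_balls [cD cD1 mu_dbl] N_qb p1 [cP [lam [cP0 lam1 mu_poin]]].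
move=> s0 mu_dim emb u Nu; have [c _ qb] := N_qb.
have [mu_ Nuoo [g ug Ngoo]] := (newton_spaceP mu_borel N_qb u).1 Nu.
have [_ g0 _] := ug; have mg := upper_gradient_measurable mu_borel ug.
have p0 : 0 < p by exact: lt_le_trans p1.
have mabs : measurable_fun setT (fun x => `|u x|%E) by exact: measurableT_comp.
have Nabs : (N (fun x => `|u x|) < +oo)%E.
  apply: le_lt_trans Nuoo; apply: (qb_lattice qb) => //.
  by apply: aeW => x; rewrite abse_id.
(* Here the estimate on means is applied to [|u|] itself rather than to [g]. *)
have uloc : locally_integrable1 mu u.
  move=> x r r0; have [e [_ _ eP]] := dyadic_means_summable mu_borel mu_balls
    N_qb p1 s0 mu_dim x mabs (fun x => abse_ge0 _) Nabs emb r0 lam1.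
  exact: integrable_of_dyadic_means eP.
have two0 n : 0 < (2 : R) ^+ n by rewrite exprn_gt0.
have means x n := dyadic_means_summable mu_borel mu_balls N_qb p1 s0 mu_dim x mg
  g0 Ngoo emb (two0 n) lam1.
pose v := dyadic_limit mu u; pose K := 3 * chain_constant cD cP.
have K0 : 0 <= K by rewrite /K; apply: mulr_ge0 => //; exact: chain_constant_ge0.
have modulus x0 n e (y z : T) k : (forall k, 0 <= e k) ->
    (\sum_(k <oo) (e k)%:E < +oo)%E -> dyadic_means_le mu p lam g x0 (2 ^+ n) e ->
    ball x0 (2 ^+ n) y -> ball x0 (2 ^+ n) z -> ball y (2 ^+ n * 2^-1 ^+ k.+1) z ->
    `|v y - v z| <= K * series_tail e k.
  move=> e0 eoo eP x0y x0z yz.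
  exact: (dyadic_limit_modulus mu_borel mu_balls cD1 mu_dbl cP0 mu_poin mu_ uloc
    ug e0 eoo eP).
clearbody K.
have cv : continuous v.
  move=> x; apply/cvgrPdist_lt => eps eps0.
  have [e [e0 eoo eP]] := means x 0%N.
  have Kt0 : (K * series_tail e k)%R @[k --> \oo] --> (0 : R)%R.
    by rewrite -(mulr0 K); apply: cvgMr => //; exact: series_tail_cvg0.
  have /cvgrPdist_lt/(_ _ eps0)[k _ /(_ k (leqnn k))] := Kt0.
  rewrite sub0r normrN ger0_norm ?mulr_ge0 ?series_tail_ge0// => Keps.
  have rk0 : 0 < (2 : R) ^+ 0 * 2^-1 ^+ k.+1 by rewrite mulr_gt0// exprn_gt0.
  have rk1 : (2 : R) ^+ 0 * 2^-1 ^+ k.+1 <= 2 ^+ 0.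
    by rewrite expr0 mul1r exprn_ile1// invf_le1// ler1n.
  have xball : ball x ((2 : R) ^+ 0) x by exact: ballxx.
  have : \forall z \near x, ball x ((2 : R) ^+ 0 * 2^-1 ^+ k.+1) z.
    exact: nbhsx_ballx.
  apply: filterS => z xz; apply: le_lt_trans Keps.
  apply: (modulus _ 0%N e _ _ k e0 eoo eP) => //.
  exact: le_ball xz.
have mv : measurable_fun setT v by exact: (continuous_measurable_funT mu_borel).
have uv : {ae mu, forall x, u x = (v x)%:E}.
  apply: (ae_eq_of_integral_balls (x0 := point)) => // n.
  have [e [e0 eoo eP]] := means point n.
  exact: (dyadic_limit_ae mu_borel mu_balls mu_dim cD1 mu_dbl cP0 mu_poin mu_ uloc
    ug e0 eoo eP mv).
have [Nv quv] := ae_eq_continuous_quasi_everywhere mu_borel N_qb Nu cv uv.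
exists v; split => // -[sp embp] x0 r r0.
have b0 : 0 < 1 - s / p by rewrite subr_gt0 ltr_pdivrMr// mul1r.
set beta := 1 - s / p in b0 *.
(* Two points of the ball are less than [2 * r] apart, so [4 * r <= 2 ^+ n] puts their distance
   below the radius 2^n / 2 that the modulus requires at k = 0. *)
pose n := (Num.truncn (4 * r)).+1.
have rn : 4 * r <= 2 ^+ n.
  apply: (@le_trans _ _ n%:R); first by rewrite ltW// truncnS_gt.
  by rewrite -natrX ler_nat ltnW// ltn_expl.
have [C C0 CP] := dyadic_means_powR mu_borel mu_balls N_qb p1 s0 mu_dim x0 mg g0 Ngoo
  embp (two0 n) lam1.
pose theta : R := 2^-1 `^ beta.
have t01 : 0 < theta < 1.
  rewrite powR_gt0//=; have := @gt0_ltr_powR _ _ b0 (2^-1) 1.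
  by rewrite powR1 !nnegrE => -> //; rewrite ?invf_lt1 ?ltr1n.
have /andP[t0 t1] := t01.
have thetaX k : (2^-1 ^+ k) `^ beta = theta ^+ k.
  by rewrite -[RHS]powR_mulrn ?powR_ge0// powRAC powR_mulrn.
pose e k := C * theta ^+ k.
have eP : dyadic_means_le mu p lam g x0 (2 ^+ n) e.
  by move=> y k x0y; rewrite /e -thetaX; exact: CP.
have e0 k : 0 <= e k by rewrite mulr_ge0 ?exprn_ge0 ?(ltW C0) ?(ltW t0).
have eoo : (\sum_(k <oo) (e k)%:E < +oo)%E.
  under eq_eseriesr do rewrite EFinM.
  rewrite nneseriesZl; last by move=> *; rewrite lee_fin exprn_ge0// ltW.
  by rewrite lte_mul_pinfty ?lee_fin ?(ltW C0)//; exact: geometric_nneseries_lty.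
(* The factor [4 / 2 ^+ n] converts the scale 2^n 2^-(k+2) into 2^-k; the [+ 1] makes [L]
   positive. *)
pose L := K * (C / (1 - theta)) * (4 / 2 ^+ n) `^ beta + 1.
have L0 : 0 < L.
  by rewrite ltr_wpDl// !mulr_ge0 ?powR_ge0// ?invr_ge0 ?subr_ge0 ?(ltW C0) ?(ltW t1).
exists L => // y z x0y x0z.
have [->|yz] := eqVneq y z.
  by rewrite subrr normr0 mulr_ge0 ?powR_ge0// ltW.
have d0 : 0 < mdist y z by rewrite mdist_gt0.
have yz2r : mdist y z < 2 * r.
  move: x0y x0z; rewrite !ballEmdist/= => x0y x0z.
  by apply: le_lt_trans (metric_triangle _ x0 _) _; rewrite (metric_sym y); lra.
have rpos k : 0 < (2 : R) ^+ n * 2^-1 ^+ k by rewrite mulr_gt0// exprn_gt0.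
(* The dyadic scale of the distance: its upper bound allows the modulus at k, its lower bound turns
   [theta ^+ k] into a power of the distance. *)
have [k k1 k2] : exists2 k, 2 ^+ n * 2^-1 ^+ k.+2 <= mdist y z &
    mdist y z < 2 ^+ n * 2^-1 ^+ k.+1.
  have exk : exists k, 2 ^+ n * 2^-1 ^+ k.+2 <= mdist y z.
    have : (2 ^+ n * 2^-1 ^+ k)%R @[k --> \oo] --> (0 : R)%R.
      by apply: cvg_geometric; rewrite ger0_norm// invf_lt1// ltr1n.
    move=> /cvgrPdist_lt/(_ _ d0)[k _ /(_ k.+2)] /=.
    move=> /(_ (leqW (leqW (leqnn k)))).
    rewrite sub0r normrN (gtr0_norm (rpos k.+2)) => h.
    by exists k; exact: ltW.
  case: (ex_minnP exk) => -[|k] km kmin.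
    by exists 0%N => //; rewrite expr1; lra.
  exists k.+1 => //; rewrite ltNge; apply/negP => /kmin; by rewrite ltnn.
have rn' : ball x0 r `<=` ball x0 (2 ^+ n) by apply: le_ball; lra.
have yzk : ball y (2 ^+ n * 2^-1 ^+ k.+1) z by rewrite ballEmdist.
apply: (le_trans (modulus x0 n e y z k e0 eoo eP (rn' _ x0y) (rn' _ x0z) yzk)).
apply: (@le_trans _ _ (K * (C / (1 - theta) * theta ^+ k))).
  by rewrite ler_wpM2l// series_tail_geometric// ltW.
have tk : theta ^+ k <= (4 / 2 ^+ n) `^ beta * mdist y z `^ beta.
  rewrite -powRM ?divr_ge0 ?(ltW d0)// -thetaX.
  rewrite ge0_ler_powR ?(ltW b0) ?nnegrE ?exprn_ge0 ?mulr_ge0 ?invr_ge0 ?(ltW d0)//.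
  have -> : (2^-1 : R) ^+ k = 4 / 2 ^+ n * (2 ^+ n * 2^-1 ^+ k.+2).
    by rewrite !exprS; field; rewrite gt_eqF.
  by rewrite ler_wpM2l// divr_ge0.
rewrite /L mulrDl mul1r ler_wpDr ?powR_ge0// mulrA -[leRHS]mulrA ler_wpM2l//.
by rewrite !mulr_ge0 ?invr_ge0 ?subr_ge0 ?(ltW C0) ?(ltW t1).
Qed.
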